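(* Let $\mathcal M_4$ be the algebraic matroid of the fourth Heron variety $X_4\subseteq\mathbb C^{26}$, with ground set $E=\{S\subseteq\{1,\dots,5\}:|S|\ge2\}$. Of the $48533$ orbits of $10$-element subsets of $E$ under the action of $\mathfrak S_5$ on the labels $\{1,\dots,5\}$, exactly $35887$ consist of bases of $\mathcal M_4$ and exactly $12646$ consist of non-bases.
   Context: For $n\ge 1$ put $e(n)=\binom{n+1}{2}$ and $N(n)=2^{n+1}-(n+1)-1$, the number of subsets $S\subseteq[n+1]=\{1,\dots,n+1\}$ with $|S|\ge 2$ (these index the positive-dimensional faces of an $n$-simplex). For variables $x_{ij}=x_{ji}$ ($1\le i<j\le n+1$) and $S=\{s_1<\dots<s_{m+1}\}\subseteq[n+1]$ with $m\ge1$, define $$x_S=\frac{(-1)^{m+1}}{(m!)^2 2^m}\det\begin{pmatrix}0&\mathbf 1^T\\ \mathbf 1&D_S\end{pmatrix},$$ where $D_S$ is the symmetric $(m+1)\times(m+1)$ matrix with zero diagonal and $(a,b)$ entry $x_{s_as_b}$ for $a\neq b$ (Cayley–Menger determinant; for $|S|=2$ this is just $x_{ij}$). This gives the polynomial map $\varphi_n:\mathbb C^{e(n)}\to\mathbb C^{N(n)}$, $(x_{ij})\mapsto(x_S)_{S\subseteq[n+1],|S|\ge2}$. The $n$-th Heron variety $X_n\subseteq\mathbb C^{N(n)}$ is the Zariski closure of the image of $\varphi_n$; it is irreducible of dimension $e(n)$. For an irreducible affine variety $X\subseteq\mathbb C^N$, the algebraic matroid $\mathcal M(X)$ has ground set the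 set of coordinate indices; its bases are the subsets $B$ for which the coordinate projection $\pi_B:X\to\mathbb C^{|B|}_B$, $\mathbf x\mapsto(x_b)_{b\in B}$, is finite-to-one (on generic fibres) and dominant. $\mathcal M_n=\mathcal M(X_n)$ has ground set $\{S\subseteq[n+1]:|S|\ge2\}$, and $\mathfrak S_{n+1}$ acts on this ground set by permuting $[n+1]$. *)

(* Defs.v *)
From HB Require Import structures.
From mathcomp Require Import all_boot all_order all_fingroup all_algebra.
From mathcomp Require Import boolp classical_sets cardinality reals.
From mathcomp Require Import complex mpoly.

Set Implicit Arguments.
Unset Strict Implicit.
Unset Printing Implicit Defensive.

Import GRing.Theory.

Local Open Scope ring_scope.
Local Open Scope classical_set_scope.

(* Affine space K^I with coordinates indexed by a finite type I is represented
   by the functions I -> K.  Polynomials over K^I have their variables numbered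
   by 'I_#|I| through the library enumeration enum_val. *)
Section AffineVarieties.
Variables (K : fieldType) (I : finType).

Definition poly_eval (p : {mpoly K[#|I|]}) (x : I -> K) : K :=
  p.@[fun i => x (enum_val i)].

Definition zariski_closure (A : set (I -> K)) : set (I -> K) :=
  [set x | forall p : {mpoly K[#|I|]},
     (forall y, A y -> poly_eval p y = 0) -> poly_eval p x = 0].

Definition zariski_closed (A : set (I -> K)) : Prop := zariski_closure A = A.

Definition zariski_open (U : set (I -> K)) : Prop := zariski_closed (~` U).

Definition coord_proj (B : {set I}) (x : I -> K) : {i : I | i \in B} -> K :=
  fun b => x (val b).

End AffineVarieties.

Arguments coord_proj {K I} B x _.

Section AlgebraicMatroid.
Variables (K : fieldType) (I : finType).

Definition dominant_proj (X : set (I -> K)) (B : {set I}) : Prop :=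
  zariski_closure (coord_proj B @` X) = setT.

(* Fibres over a nonempty, hence dense when K is infinite, Zariski open subset
   of the target. *)
Definition generically_finite_proj (X : set (I -> K)) (B : {set I}) : Prop :=
  exists U : set ({i : I | i \in B} -> K),
    [/\ zariski_open U, U !=set0 &
        forall y, U y -> finite_set (X `&` [set x | coord_proj B x = y])].

Definition algebraic_matroid_basis (X : set (I -> K)) (B : {set I}) : Prop :=
  generically_finite_proj X B /\ dominant_proj X B.

End AlgebraicMatroid.

(* The label set {1, ..., n+1} is 'I_n.+1. *)
Definition edge (n : nat) : finType := {e : {set 'I_n.+1} | #|e| == 2}.

Definition face (n : nat) : finType := {S : {set 'I_n.+1} | (2 <= #|S|)%N}.

Section HeronVariety.
Variables (K : fieldType) (n : nat).

(* x_ij; for i = j the set [set i; j] is not an edge, so the value is 0. *)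
Definition sqdist (x : edge n -> K) (i j : 'I_n.+1) : K :=
  if insub [set i; j]%SET is Some e then x e else 0.

Definition dist_mx (x : edge n -> K) (S : {set 'I_n.+1}) : 'M[K]_#|S| :=
  \matrix_(a, b) sqdist x (enum_val a) (enum_val b).

(* With #|S| = m + 1. *)
Definition cayley_menger (x : edge n -> K) (S : {set 'I_n.+1}) : K :=
  let m := #|S|.-1 in
  (-1) ^+ m.+1 / ((m`!)%:R ^+ 2 * 2 ^+ m) *
  \det (block_mx (0 : 'M[K]_1) (const_mx 1) (const_mx 1) (dist_mx x S)).

Definition heron_map (x : edge n -> K) : face n -> K :=
  fun S => cayley_menger x (val S).

Definition heron_variety : set (face n -> K) :=
  zariski_closure (range heron_map).

End HeronVariety.

Section FaceAction.
Variable n : nat.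

Lemma face_act_subproof (S : face n) (s : 'S_n.+1) :
  (2 <= #|s @: val S|)%N.
Proof. by rewrite card_imset ?(valP S) //; apply: perm_inj. Qed.

Definition face_act (S : face n) (s : 'S_n.+1) : face n :=
  exist _ (s @: val S)%SET (face_act_subproof S s).

Lemma face_act1 : face_act^~ 1%g =1 id.
Proof.
move=> S; apply: val_inj => /=.
by rewrite (eq_imset _ (@perm1 _)) imset_id.
Qed.

Lemma face_actM (S : face n) : act_morph face_act S.
Proof.
move=> s t; apply: val_inj => /=.
by rewrite -imset_comp; apply: eq_imset => i; rewrite permM.
Qed.

Canonical face_action := TotalAction face_act1 face_actM.

(* Orbits of 'S_n.+1 on the k-element subsets of the ground set; ^* is the
   induced action on sets of faces. *)
Definition face_set_orbits (k : nat) : {set {set {set face n}}} :=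
  [set orbit (face_action^*)%act [set: 'S_n.+1] B
    | B : {set face n} in [set B : {set face n} | #|B| == k]]%SET.

End FaceAction.

(* Main.v *)
(* In coordinates x = (x_ij), the Heron variety is the closure of the image of a
   polynomial map whose source has dimension 10, so a set of ten faces is a basis
   exactly when the gradients of its ten Cayley-Menger determinants are linearly
   independent at a generic point: a nonzero Jacobian at one point gives a basis
   (chain rule applied to an algebraic relation of minimal degree), while ten
   algebraically independent polynomials have a Jacobian determinant that is not
   identically zero.

   Bases are thus certified by an elimination modulo 3 at one of sixteen integer
   points.  Nonbases are certified by thirteen flats, up to relabelling: every
   nonbasis meets one of them in more faces than its rank.  Seven of these flats
   are spanned by the edges they contain; the rank of the other six is bounded
   with vector fields that annihilate their volumes, such as the shears moving a
   vertex in the direction of the segment 01, or with identities of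
   Desnanot-Jacobi type between the Cayley-Menger determinants.

   Orbits are counted by their lexicographically smallest codes: edges, then
   tetrahedra, then the whole simplex, then triangles.  Pruning each block with
   the stabilizer of the preceding ones enumerates the 48533 smallest codes, and
   the two kinds of certificates decide all of them. *)

Require Import Defs.
From HB Require Import structures.
From mathcomp Require Import all_boot all_order all_fingroup all_algebra.
From mathcomp Require Import boolp classical_sets cardinality reals.
From mathcomp Require Import complex mpoly.
From mathcomp Require Import zify ring.
From Stdlib Require BinNat PeanoNat.

Set Implicit Arguments.
Unset Strict Implicit.
Unset Printing Implicit Defensive.

Import GRing.Theory Num.Theory.

Local Open Scope ring_scope.

(** * Algebraic independence and Jacobians *)

(** Three obstacles shape the proof. The variety is a Zariski closure, so its points need not be
    images: facts about it are polynomial identities, checked on the image and extended by closure.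
    A generic point is not at hand for computation, so every rank bound carries a nonzero polynomial
    [g] and is claimed only where [g] does not vanish. The prefactor of the Cayley-Menger
    determinant has no meaning modulo 3 once 3! enters its denominator; nonzero factors do not
    affect the independence of gradients, so computations use the bare determinants, which have
    integer coefficients, and a minor that is nonzero modulo 3 is a nonzero integer, hence nonzero
    in characteristic zero.

    A single determinant program over a bare record of operations is run over polynomials, the
    field, the integers, the three-element field and dual numbers; a relational transfer lemma links
    the results, so derivatives need no formula of their own. Three elements reduce arithmetic to
    case analysis on [option bool]; several sample points make up for minors that happen to vanish
    modulo 3. *)

Notation msubst f := (mmap (@mpolyC _ _) f).

Section ChainRule.
Variables (K : fieldType) (n : nat) (A : comNzRingType).
Variables (c : {rmorphism K -> A}) (h : 'I_n -> A) (D : {additive A -> A}).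
Hypothesis D_mul : forall a b, D (a * b) = D a * b + a * D b.
Hypothesis D_const : forall k, D (c k) = 0.

Lemma derivation_exp a k : D (a ^+ k) = a ^+ k.-1 *+ k * D a.
Proof.
have D1 : D 1 = 0 by rewrite -(rmorph1 c) D_const.
elim: k => [|k IHk]; first by rewrite expr0 D1 mulr0n mul0r.
rewrite exprS D_mul IHk /=.
case: k {IHk} => [|k]; first by rewrite expr0 mulr0n !mul0r mulr0 addr0 mulr1 mul1r.
rewrite [in RHS]mulrSr mulrDl [RHS]addrC [D a * _]mulrC; congr (_ + _).
by rewrite mulrA mulrnAr -exprS.
Qed.

Lemma derivation_prod (I : finType) (F : I -> A) :
  D (\prod_i F i) = \sum_i D (F i) * \prod_(j | j != i) F j.
Proof.
have D1 : D 1 = 0 by rewrite -(rmorph1 c) D_const.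
suff gen (s : seq I) : uniq s ->
    D (\prod_(i <- s) F i) = \sum_(i <- s) D (F i) * \prod_(j <- s | j != i) F j.
  exact: gen (index_enum_uniq I).
elim: s => [|i s IHs] /=; first by rewrite !big_nil D1.
case/andP=> nis us; rewrite !big_cons D_mul IHs // eqxx /=; congr (_ + _).
  congr (_ * _); rewrite [LHS]big_seq [RHS]big_seq_cond; apply: eq_bigl => j.
  by case: (boolP (j \in s)) => //= js; apply/esym/eqP => eji; rewrite -eji js in nis.
rewrite mulr_sumr big_seq [RHS]big_seq; apply: eq_bigr => j js.
rewrite big_cons; case: eqP => [eij|_]; first by rewrite eij js in nis.
by rewrite /= mulrCA.
Qed.

(** The derivation is abstract because two are used: [deriv] on [{poly K}], for restrictions to a
    line, and [mderiv] on [{mpoly K[n]}]. *)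
Lemma chain_rule (p : {mpoly K[n]}) :
  D (mmap c h p) = \sum_i mmap c h p^`M(i) * D (h i).
Proof.
elim/mpolyind: p => [|a m p _ _ IHp].
  by rewrite mmap0 raddf0 big1 // => i _; rewrite mderiv0 mmap0 mul0r.
rewrite mmapD raddfD /= IHp.
under [RHS]eq_bigr => i _ do rewrite mderivD mmapD mulrDl.
rewrite big_split /=; congr (_ + _).
rewrite mmapZ D_mul D_const mul0r add0r mmapX /mmap1.
rewrite derivation_prod mulr_sumr; apply: eq_bigr => i _.
rewrite mderivZ mderivX !mmapZ mmapX /mmap1 rmorph_nat derivation_exp.
have mUE j : ((m - U_(i))%MM j = m j - (i == j))%N by rewrite mnmBE mnm1E.
rewrite [in RHS](bigD1 i) //= mUE eqxx subn1.
rewrite [in RHS](eq_bigr (fun j => h j ^+ m j)); last first.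
  by move=> j /negPf nji; rewrite mUE eq_sym nji subn0.
rewrite -[RHS]mulrA; congr (_ * _); by rewrite mulr_natl -mulrnAl mulrAC.
Qed.

End ChainRule.

Lemma rmorph_mmap (K A B : comNzRingType) n (g : {rmorphism A -> B})
    (c : K -> A) (h : 'I_n -> A) (p : {mpoly K[n]}) :
  g (mmap c h p) = mmap (g \o c) (g \o h) p.
Proof.
rewrite rmorph_sum; apply: eq_bigr => m _; rewrite rmorphM rmorph_prod.
by congr (_ * _); apply: eq_bigr => i _; rewrite rmorphXn.
Qed.

Lemma eq_mmap (K A : nzRingType) n (c c' : K -> A) (h h' : 'I_n -> A) :
  c =1 c' -> h =1 h' -> mmap c h =1 mmap c' h'.
Proof.
move=> ec eh p; apply: eq_bigr => m _; rewrite ec; congr (_ * _).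
by apply: eq_bigr => i _; rewrite eh.
Qed.

Section CharZero.
Variable K : numFieldType.

(** [A] is merely a ring over [K]; the factor [j.+1] is cancelled by the image of its inverse in
    [K]. *)
Lemma deriv_eq0 (A : comNzRingType) (c : {rmorphism K -> A}) (P : {poly A}) :
  P^`() = 0 -> (size P <= 1)%N.
Proof.
move=> dP0; apply/leq_sizeP => -[//|j] _.
have := congr1 (fun Q : {poly A} => Q`_j) dP0.
rewrite coef_deriv coef0 -mulr_natr -(rmorph_nat c) => Pj0.
have /(congr1 (fun z => z * c (j.+1%:R^-1))) := Pj0.
by rewrite mul0r -mulrA -rmorphM mulfV ?rmorph1 ?mulr1 // pnatr_eq0.
Qed.

Lemma poly_vanish (P : {poly K}) : (forall t, P.[t] = 0) -> P = 0.
Proof.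
move=> P0; apply/eqP; case: (eqVneq P 0) => // nzP.
pose s := [seq i%:R : K | i <- iota 0 (size P)].
have us : uniq s.
  by rewrite map_inj_uniq ?iota_uniq // => i j /eqP; rewrite eqr_nat => /eqP.
have rs : all (root P) s by apply/allP => t _; apply/rootP/P0.
by have := max_poly_roots nzP rs us; rewrite size_map size_iota ltnn.
Qed.

Section Mpoly.
Variable n : nat.
Implicit Type p : {mpoly K[n]}.

Lemma mderiv_eq0 p : (forall i, p^`M(i) = 0) -> p = (p@_0%MM)%:MP.
Proof.
move=> dp0; apply/mpolyP => m; rewrite mcoeffC.
case: (eqVneq m 0%MM) => [->|nz_m]; first by rewrite mulr1.
rewrite mulr0; have /existsP[i nz_mi] : [exists i, m i != 0%N].
  apply/contraNT: nz_m; rewrite negb_exists => /forallP m0.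
  by apply/eqP/mnmP => i; rewrite mnm0E; apply/eqP; rewrite -[_ == _]negbK.
have := congr1 (mcoeff (m - U_(i))%MM) (dp0 i).
rewrite mcoeff_mderiv mcoeff0 submK; last by rewrite lep1mP.
by move=> /eqP; rewrite mulrn_eq0 => /orP[//|/eqP].
Qed.

Lemma msize_mderiv p i : p != 0 -> (msize p^`M(i) < msize p)%N.
Proof.
move=> nz_p; have := nz_p; rewrite -msize_poly_eq0 -lt0n => sz_p.
rewrite msizeE -(prednK sz_p) ltnS; apply/bigmax_leqP_seq => m + _.
rewrite mcoeff_msupp mcoeff_mderiv => nz_pm.
have /msize_mdeg_lt : (m + U_(i))%MM \in msupp p.
  by rewrite mcoeff_msupp; apply: contraNneq nz_pm => ->; rewrite mul0rn.
by rewrite mdegD mdeg1 addn1 -[in X in X -> _](prednK sz_p) ltnS.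
Qed.

(** On a line parallel to a coordinate axis [p] has infinitely many zeros, so its partial
    derivatives vanish everywhere; by induction on the degree they are zero, and [p] is constant. *)
Lemma mpoly_vanish p : (forall x, p.@[x] = 0) -> p = 0.
Proof.
have [k] := ubnP (msize p); elim: k p => // k IHk p; rewrite ltnS => sz_p p0.
apply/eqP; case: (eqVneq p 0) => // nz_p; apply: contraNT (nz_p) => _.
have dp0 i : p^`M(i) = 0.
  apply: IHk => [|x]; first exact: leq_trans (msize_mderiv _ nz_p) sz_p.
  (* The line through [x] in the direction of the [i]-th coordinate. *)
  pose h j : {poly K} := (x j)%:P + (i == j)%:R *: 'X.
  pose q := mmap polyC h p.
  have horner_q (r : {mpoly K[n]}) t :
      (mmap polyC h r).[t] = r.@[fun j => x j + (i == j)%:R * t].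
    rewrite -horner_evalE rmorph_mmap; apply: eq_mmap => j /=.
      by rewrite horner_evalE hornerC.
    by rewrite horner_evalE hornerD hornerC hornerZ hornerX.
  have q0 : q = 0 by apply: poly_vanish => t; rewrite horner_q.
  have := chain_rule (c := polyC) h (D := deriv) (@derivM K) (@derivC K) p.
  rewrite -[mmap _ h p]/q q0 /= deriv0 (bigD1 i) //= big1 => [|j /negPf nji].
    rewrite addr0 derivD derivC add0r eqxx scale1r derivX mulr1.
    move=> /(congr1 (fun Q : {poly K} => Q.[0])); rewrite horner0 horner_q => ->.
    by apply: meval_eq => j; rewrite mulr0 addr0.
  by rewrite derivD derivC add0r eq_sym nji scale0r deriv0 mulr0.
by have := p0 (fun _ => 0); rewrite (mderiv_eq0 dp0) mevalC => ->.
Qed.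
End Mpoly.

Section Dependence.
Variable n : nat.
Implicit Types p q : {mpoly K[n]}.

Let degb (d : nat) p := (msize p <= d.+1)%N.

Let degbM d e p q : degb d p -> degb e q -> degb (d + e) (p * q).
Proof.
rewrite /degb => dp dq; case: (eqVneq p 0) => [->|nz_p]; first by rewrite mul0r msize0.
case: (eqVneq q 0) => [->|nz_q]; first by rewrite mulr0 msize0.
by rewrite msizeM // -subn1 leq_subLR (leq_trans (leq_add dp dq)) // addnS.
Qed.

Let degbX d p k : degb d p -> degb (k * d) (p ^+ k).
Proof.
move=> dp; elim: k => [|k IHk]; first by rewrite expr0 /degb msize1.
by rewrite exprS mulSn; apply: degbM.
Qed.

Let degb_prod (I : finType) (d : I -> nat) (F : I -> {mpoly K[n]}) :
  (forall i, degb (d i) (F i)) -> degb (\sum_i d i) (\prod_i F i).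
Proof.
move=> dF; elim/big_rec2: _ => [|i e p _ dp]; first by rewrite /degb msize1.
exact: degbM.
Qed.

(* If all degrees are at most D, the d ^ n.+1 products of the f i and g with
   exponents below d have degree less than b = n.+1 * d * D + 1, so they live
   in a space of dimension at most b ^ n, which is smaller for large d. *)
Lemma transcendence_bound (f : 'I_n -> {mpoly K[n]}) (g : {mpoly K[n]}) :
  exists2 P : {poly {mpoly K[n]}}, P != 0 & (map_poly (msubst f) P).[g] = 0.
Proof.
pose D := maxn (\max_i msize (f i)) (msize g).
have df i : degb D (f i).
  by apply: leqW; rewrite leq_max; apply/orP; left; apply: leq_bigmax.
have dg : degb D g by apply: leqW; rewrite leq_max leqnn orbT.
(* With q = n.+1 * D + 2 one has b <= q * d, so b ^ n <= q ^ n * d ^ n < q ^ n.+1 * d ^ n = d ^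
   n.+1; hence the choice d = q ^ n.+1. *)
pose d := ((n.+1 * D + 2) ^ n.+1)%N; pose b := (n.+1 * (d * D)).+1.
pose A : finType := ({ffun 'I_n -> 'I_d} * 'I_d)%type.
pose u (a : A) := (\prod_i f i ^+ a.1 i) * g ^+ a.2.
have du a : (msize (u a) <= b)%N.
  have -> : b = (n * (d * D) + d * D).+1 by rewrite /b mulSn addnC.
  have dX (k : 'I_d) p : degb D p -> degb (d * D) (p ^+ k).
    move=> /(degbX k) dp; apply: leq_trans dp _.
    by rewrite ltnS leq_mul2r (ltnW (ltn_ord k)) orbT.
  apply: degbM; last exact: dX.
  rewrite -[n in (n * _)%N]card_ord -sum_nat_const.
  by apply: degb_prod => i; apply: dX.
pose M : 'M[K]_(#|A|, #|{: 'X_{1..n < b}}|) :=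
  \matrix_(r, s) (u (enum_val r))@_(enum_val s : 'X_{1..n < b}).
have leM : (#|{: 'X_{1..n < b}}| < #|A|)%N.
  have lecard : (#|{: 'X_{1..n < b}}| <= b ^ n)%N.
    have <- : #|{ffun 'I_n -> 'I_b}| = (b ^ n)%N by rewrite card_ffun !card_ord.
    pose h (m : 'X_{1..n < b}) : {ffun 'I_n -> 'I_b} := [ffun i => inord (m i)].
    apply: (leq_card h) => m1 m2 /ffunP eh; apply/val_inj/mnmP => i.
    have mi_lt (m : 'X_{1..n < b}) : (m i < b)%N.
      apply: leq_ltn_trans (bmdeg m).
      by rewrite mdegE (bigD1 i) //= leq_addr.
    by have := congr1 val (eh i); rewrite !ffunE /= !inordK ?mi_lt.
  apply: leq_ltn_trans lecard _.
  rewrite card_prod card_ffun !card_ord -expnSr.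
  have d_gt0 : (0 < d)%N by rewrite expn_gt0 addn2.
  have le_b : (b <= (n.+1 * D + 2) * d)%N by rewrite /b; nia.
  have le_bX k : (b ^ k <= ((n.+1 * D + 2) * d) ^ k)%N.
    by case: k => // k; rewrite leq_exp2r.
  apply: leq_ltn_trans (le_bX n) _.
  rewrite expnMn [X in (_ < X)%N]expnS ltn_pmul2r; first by rewrite /d ltn_exp2l // addn2.
  by move: d_gt0; clearbody d => d_gt0; rewrite expn_gt0 d_gt0.
have [v nz_v vM0] : exists2 v : 'rV_#|A|, v != 0 & v *m M = 0.
  have : kermx M != 0.
    by rewrite kermx_eq0 -row_leq_rank -ltnNge (leq_ltn_trans (rank_leq_col M) leM).
  case/rowV0Pn => v; rewrite sub_kermx => /eqP vM0 nz_v.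
  by exists v.
pose c (a : A) := v 0 (enum_rank a).
pose mon (al : {ffun 'I_n -> 'I_d}) := [multinom (al i : nat) | i < n].
pose Q (k : 'I_d) := \sum_al c (al, k) *: 'X_[mon al] : {mpoly K[n]}.
have mon_inj : injective mon.
  by move=> al be /mnmP e; apply/ffunP => i; apply/val_inj; have := e i; rewrite !mnmE.
have QE al k : (Q k)@_(mon al) = c (al, k).
  rewrite raddf_sum (bigD1 al) //= big1 => [|be /negPf ne].
    by rewrite addr0 mcoeffZ mcoeffX eqxx mulr1.
  by rewrite mcoeffZ mcoeffX (inj_eq mon_inj) ne mulr0.
have subQ k : msubst f (Q k) = \sum_al c (al, k) *: \prod_i f i ^+ al i.
  rewrite raddf_sum; apply: eq_bigr => al _; rewrite /= mmapZ mmapX mul_mpolyC.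
  by congr (_ *: _); apply: eq_bigr => i _; rewrite mnmE.
(* Distinct exponents give distinct monomials, so the entries of the kernel vector are coefficients
   of this relation, which is therefore nonzero. *)
exists (\sum_(k < d) Q k *: 'X^k).
  apply: contraNneq nz_v => Q0; apply/eqP/rowP => r; rewrite mxE.
  case eqr : (enum_val r) => [al k]; rewrite -(enum_valK r) eqr -/(c _) -QE.
  have := congr1 (fun P : {poly _} => P`_k) Q0; rewrite coef0 coef_sum.
  rewrite (bigD1 k) //= coefZ coefXn eqxx mulr1 big1 => [|l /negPf nlk].
    by rewrite addr0 => ->; rewrite mcoeff0.
  by rewrite coefZ coefXn eq_sym (nlk : (l == k :> nat) = false) mulr0.
rewrite -horner_evalE !raddf_sum /=.
transitivity (\sum_a c a *: u a).
  rewrite [RHS](eq_bigr (fun a => c (a.1, a.2) *: u (a.1, a.2))); last by case.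
  rewrite -(pair_bigA _ (fun al k => c (al, k) *: u (al, k))) exchange_big /=.
  apply: eq_bigr => k _; rewrite map_polyZ /= map_polyXn horner_evalE hornerZ.
  rewrite hornerXn subQ mulr_suml; apply: eq_bigr => al _.
  by rewrite -scalerAl.
apply/mpolyP => m; rewrite mcoeff0 raddf_sum /=.
case: (ltnP (mdeg m) b) => [ltm|gem]; last first.
  rewrite big1 // => a _; rewrite mcoeffZ [_@_m]memN_msupp_eq0 ?mulr0 //.
  by apply: msize_mdeg_ge; apply: leq_trans (du a) gem.
have := congr1 (fun w : 'rV_ _ => w 0 (enum_rank (BMultinom ltm))) vM0.
rewrite !mxE => vMm; rewrite -[RHS]vMm [LHS](reindex (@enum_val A A)) /=; last exact/onW_bij/enum_val_bij.
apply: eq_bigr => r _.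
by rewrite mcoeffZ /c enum_valK mxE enum_rankK.
Qed.
End Dependence.

(** * The Jacobian criterion for algebraic independence *)

Section JacobianCriterion.
Variables (m n : nat).
Implicit Type f : 'I_m -> {mpoly K[n]}.

Definition alg_indep f := forall p, msubst f p = 0 -> p = 0.

Definition jacobian f : 'M_(m, n) := \matrix_(i, j) (f i)^`M(j).

Lemma mderiv_subst f (p : {mpoly K[m]}) j :
  (msubst f p)^`M(j) = \sum_i msubst f p^`M(i) * (f i)^`M(j).
Proof.
have dM (a b : {mpoly K[n]}) : mderiv j (a * b) = mderiv j a * b + a * mderiv j b by exact: mderivM.
have dC k : mderiv j (@mpolyC n K k) = 0 by exact: mderivC.
exact: (chain_rule f dM dC p).
Qed.

Lemma mderiv_horner_subst f (P : {poly {mpoly K[m]}}) (g : {mpoly K[n]}) j :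
  ((map_poly (msubst f) P).[g])^`M(j) =
    \sum_i (map_poly (msubst f) (map_poly (mderiv i) P)).[g] * (f i)^`M(j)
    + (map_poly (msubst f) P^`()).[g] * g^`M(j).
Proof.
elim/poly_ind: P => [|P c IHP].
  rewrite deriv0 !map_poly0 horner0 mderiv0 mul0r addr0 big1 // => i _.
  by rewrite !map_poly0 horner0 mul0r.
have map_mderiv i : map_poly (mderiv i) (P * 'X + c%:P) =
    map_poly (mderiv i) P * 'X + (c^`M(i))%:P.
  apply/polyP => k; rewrite coefD coefMX coefC coef_map_id0 ?mderiv0 //.
  rewrite coefD coefMX coefC mderivD [in RHS]coef_map_id0 ?mderiv0 //.
  by case: k => //=; rewrite !mderiv0.
under eq_bigr => i _ do
  rewrite map_mderiv rmorphD rmorphM /= map_polyX map_polyC hornerMXaddC mulrDl.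
rewrite big_split /= derivD derivM derivC derivX mulr1 addr0.
rewrite !rmorphD !rmorphM /= map_polyX map_polyC hornerMXaddC hornerD hornerMX.
rewrite mderivD mderivM IHP mderiv_subst.
under [in RHS]eq_bigr => i _ do rewrite mulrAC.
rewrite -mulr_suml; ring.
Qed.

End JacobianCriterion.

Section SquareJacobian.
Variables (n : nat) (f : 'I_n -> {mpoly K[n]}).

Lemma jacobian_alg_indep : \det (jacobian f) != 0 -> alg_indep f.
Proof.
move=> nz_det p; have [k] := ubnP (msize p); elim: k p => // k IHk p.
rewrite ltnS => sz_p fp0; apply/eqP; case: (eqVneq p 0) => // nz_p.
have dp0 i : p^`M(i) = 0.
  apply: IHk; first exact: leq_trans (msize_mderiv i nz_p) sz_p.
  pose v := \row_i msubst f p^`M(i).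
  have vJ0 : v *m jacobian f = 0.
    have := fun j => mderiv_subst f p j; rewrite fp0 => dfp0.
    apply/rowP => j; rewrite !mxE -[RHS](mderiv0 K j) dfp0.
    by apply: eq_bigr => l _; rewrite !mxE.
  (* The entries are polynomials, so the adjugate replaces the inverse: each entry of [v] times the
     determinant is zero. *)
  have := congr1 (mulmx^~ (\adj (jacobian f))) vJ0.
  rewrite -mulmxA mul_mx_adj mul_mx_scalar mul0mx => /rowP/(_ i)/eqP.
  by rewrite !mxE mulf_eq0 (negPf nz_det) => /eqP.
case/negP: nz_p; move: fp0; rewrite (mderiv_eq0 dp0) mmapC => /eqP.
by rewrite !mpolyC_eq0.
Qed.

(* A relation P (f, 'X_j) = 0 of minimal degree in its last variable stays
   nontrivial after differentiating in that variable; differentiating the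
   relations for all j yields a diagonal matrix with nonzero determinant that
   is a multiple of the Jacobian matrix. *)
Lemma alg_indep_jacobian : alg_indep f -> \det (jacobian f) != 0.
Proof.
move=> indf; pose ev j (P : {poly {mpoly K[n]}}) := (map_poly (msubst f) P).['X_j].
have minP j : exists2 P, P != 0 /\ ev j P = 0 & ev j P^`() != 0.
  have [P nzP Pj0] := transcendence_bound f 'X_j.
  have [k] := ubnP (size P); elim: k P nzP Pj0 => // k IHk P nzP Pj0.
  (* If the derivative is again a relation, it replaces [P] with smaller degree. It is nonzero: a
     [P] constant in its last variable would be a relation among the [f i] alone. *)
  rewrite ltnS => szP; case: (eqVneq (ev j P^`()) 0) => [dP0|nz_dP]; last by exists P.
  have nz_dP : P^`() != 0.
    apply: contra_neq nzP => /(deriv_eq0 (@mpolyC n K)) /size1_polyC eP.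
    by move: Pj0; rewrite eP map_polyC hornerC => /indf ->.
  exact: (IHk _ nz_dP dP0 (leq_trans (lt_size_deriv nzP) szP)).
have /choice[P Pann] : forall j, exists P, (P != 0 /\ ev j P = 0) /\ ev j P^`() != 0.
  by move=> j; have [P] := minP j; exists P.
pose M := \matrix_(j, i) ev j (map_poly (mderiv i) (P j)).
pose N := \row_j - ev j (P j)^`().
have MJ : M *m jacobian f = diag_mx N.
  apply/matrixP => j l; rewrite !mxE.
  have := mderiv_horner_subst f (P j) 'X_j l.
  have [[_ Pj0] _] := Pann j; rewrite /ev in Pj0; rewrite Pj0 mderiv0 => /esym/eqP.
  rewrite addr_eq0 => /eqP Mjl.
  rewrite (eq_bigr (fun i => (map_poly (msubst f) (map_poly (mderiv i) (P j))).['X_j] * (f i)^`M(l))); last by move=> i _; rewrite !mxE.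
  rewrite Mjl mderivX mnm1E; case: (eqVneq j l) => [->|nejl].
    have -> : (U_(l) - U_(l))%MM = 0%MM :> 'X_{1..n}.
      by apply/mnmP => i; rewrite mnmBE subnn mnm0E.
    by rewrite scale1r mpolyX0 mulr1 mulr1n.
  by rewrite scale0r mulr0 oppr0 mulr0n.
have := congr1 determinant MJ; rewrite det_mulmx det_diag => detMJ.
apply: contraTneq isT => det0; move: detMJ; rewrite det0 mulr0 => /esym/eqP.
rewrite prodf_seq_eq0 => /hasP[j _]; rewrite !mxE /= oppr_eq0.
by have [_ /negPf->] := Pann j.
Qed.
End SquareJacobian.

(** Phrased without a determinant because [m] and [n] will be cardinals that are equal only
    propositionally. *)
Definition grad_free m n (f : 'I_m -> {mpoly K[n]}) (x : 'I_n -> K) :=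
  forall v : 'I_m -> K, (forall j, \sum_i v i * ((f i)^`M(j)).@[x] = 0) ->
  forall i, v i = 0.

Lemma grad_free_det n (f : 'I_n -> {mpoly K[n]}) x :
  grad_free f x <-> (\det (jacobian f)).@[x] != 0.
Proof.
have -> : (\det (jacobian f)).@[x] = \det (map_mx (meval x) (jacobian f)).
  by rewrite det_map_mx.
split=> [freef|/det0P nodep v vJ0 i].
  apply/det0P => -[v /rV0Pn[i nz_vi] vJ0]; case/eqP: nz_vi.
  apply: (freef (v 0)) => j; have /rowP/(_ j) := vJ0; rewrite !mxE => vJj.
  by rewrite -[RHS]vJj; apply: eq_bigr => k _; rewrite !mxE.
apply/eqP/negPn/negP => nz_vi; apply: nodep; exists (\row_k v k).
  by apply/rV0Pn; exists i; rewrite mxE.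
apply/rowP => j; rewrite !mxE -[RHS](vJ0 j).
by apply: eq_bigr => k _; rewrite !mxE.
Qed.

Lemma grad_free_alg_indep m n (f : 'I_m -> {mpoly K[n]}) x :
  m = n -> grad_free f x -> alg_indep f.
Proof.
move=> emn; case: n / emn f x => f x /grad_free_det nz_det.
by apply: jacobian_alg_indep; apply: contraNneq nz_det => ->; rewrite meval0.
Qed.

Lemma alg_indep_grad_free m n (f : 'I_m -> {mpoly K[n]}) (g : {mpoly K[n]}) :
  m = n -> g != 0 -> alg_indep f -> exists2 x, g.@[x] != 0 & grad_free f x.
Proof.
move=> emn; case: n / emn f g => f g nz_g /alg_indep_jacobian nz_det.
have [x nz_x] : exists x, (g * \det (jacobian f)).@[x] != 0.
  apply: contrapT => /forallNP g0; have := mulf_neq0 nz_g nz_det.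
  by case/eqP; apply: mpoly_vanish => x; apply/eqP/negPn/negP/g0.
move: nz_x; rewrite mevalM mulf_eq0 => /norP[nz_gx nz_detx].
by exists x => //; apply/grad_free_det.
Qed.

Lemma algebraic_over_family m n (f : 'I_m -> {mpoly K[n]}) (g : {mpoly K[n]}) :
  m = n -> exists2 P : {poly {mpoly K[m]}}, P != 0 & (map_poly (msubst f) P).[g] = 0.
Proof. by move=> emn; case: n / emn f g; apply: transcendence_bound. Qed.

Lemma roots_finite (q : {poly K}) :
  q != 0 -> exists s : seq K, forall x, root q x -> x \in s.
Proof.
have [k] := ubnP (size q); elim: k q => // k IHk q; rewrite ltnS => szq nzq.
case: (pselect (exists a, root q a)) => [[a /factor_theorem[r eq]]|noroot]; last first.
  by exists [::] => x qx; case: noroot; exists x.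
have nzr : r != 0 by apply: contraNneq nzq => r0; rewrite eq r0 mul0r.
have [|//|s rs] := IHk r.
  by move: szq; rewrite eq size_Mmonic ?monicXsubC // size_XsubC addn2.
exists (a :: s) => x; rewrite eq rootM root_XsubC inE orbC.
by case/orP=> [->//|/rs->]; rewrite orbT.
Qed.

End CharZero.

(** * Parametrized varieties *)

Section ParametrizedVariety.
Variables (K : numFieldType) (I J : finType) (phi : J -> {mpoly K[#|I|]}).

Local Open Scope classical_set_scope.

Definition parametrization (x : I -> K) : J -> K := fun j => poly_eval (phi j) x.

Definition parametrized_variety : set (J -> K) :=
  zariski_closure (range parametrization).

Local Notation X := parametrized_variety.

Variable B : {set J}.

Definition subfamily (k : 'I_#|{: {j | j \in B}}|) := phi (val (enum_val k)).

Lemma poly_eval_subst m (f : 'I_m -> {mpoly K[#|I|]}) (p : {mpoly K[m]}) x :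
  poly_eval (msubst f p) x = p.@[fun k => poly_eval (f k) x].
Proof.
rewrite /poly_eval rmorph_mmap; apply: eq_mmap => [a|k] //=.
exact: mevalC.
Qed.

Lemma poly_eval_rank (T : finType) (z : T -> K) (p : {mpoly K[#|T|]}) w :
  z =1 w \o enum_rank -> poly_eval p z = p.@[w].
Proof. by move=> zw; apply: meval_eq => k; rewrite zw /= enum_valK. Qed.

Definition coord_lift (p : {mpoly K[#|{: {j | j \in B}}|]}) : {mpoly K[#|J|]} :=
  msubst (fun k => 'X_(enum_rank (val (enum_val k)))) p.

Lemma poly_eval_coord_lift p y :
  poly_eval (coord_lift p) y = poly_eval p (coord_proj B y).
Proof.
rewrite /poly_eval rmorph_mmap; apply: eq_mmap => [a|k] /=; first exact: mevalC.
by rewrite mevalXU enum_rankK.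
Qed.

(** A polynomial in the coordinates of [B] vanishes on the projection of [X] exactly when it
    vanishes on the projected image, that is, when it is a relation of the subfamily; closing up
    adds no equation. *)
Lemma dominant_proj_parametrized :
  dominant_proj X B <-> alg_indep subfamily.
Proof.
split=> [dom p fp0|indep].
  apply: mpoly_vanish => w; pose z b := w (enum_rank b).
  rewrite -(poly_eval_rank (z := z)) //.
  have : zariski_closure (coord_proj B @` X) z by rewrite dom.
  apply=> _ [y Xy <-]; rewrite -poly_eval_coord_lift; apply: Xy => _ [x _ <-].
  have := poly_eval_subst subfamily p x; rewrite fp0 [LHS]meval0 => fpx.
  by rewrite poly_eval_coord_lift [RHS]fpx.
apply/seteqP; split=> // z _ p p0.
suff -> : p = 0 by exact: meval0.
apply: indep; apply: mpoly_vanish => w; pose x i := w (enum_rank i).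
rewrite -(poly_eval_rank (z := x)) // poly_eval_subst.
rewrite -[LHS]/(poly_eval p (coord_proj B (parametrization x))).
apply: p0; exists (parametrization x) => // q q0; apply: q0.
by exists x.
Qed.

Hypothesis cardB : #|B| = #|I|.

Let cardBI : #|{: {j | j \in B}}| = #|I|.
Proof. by rewrite card_sig -cardB; apply: eq_card. Qed.

(** Every [phi j] is algebraic over a family with as many members as there are variables. Where no
    leading coefficient vanishes, each coordinate of a fibre is confined to the roots of a nonzero
    polynomial. Among sets of this size, dominance alone thus separates bases from nonbases. *)
Lemma generically_finite_parametrized : generically_finite_proj X B.
Proof.
have /choice[P Pann] := fun j => let: ex_intro2 P a b :=
  algebraic_over_family subfamily (phi j) cardBI in ex_intro (fun P =>
    P != 0 /\ (map_poly (msubst subfamily) P).[phi j] = 0) P (conj a b).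
pose g := \prod_j lead_coef (P j).
have nz_g : g != 0.
  by apply/prodf_neq0 => j _; rewrite lead_coef_eq0; have [] := Pann j.
pose Q j y : {poly K} := map_poly (fun p => poly_eval p y) (P j).
have nzQ j y : poly_eval g y != 0 -> Q j y != 0.
  rewrite /poly_eval rmorph_prod => /prodf_neq0/(_ j isT) nzl.
  apply: contraNneq nzl => Q0; have := congr1 (fun q : {poly K} => q`_(size (P j)).-1) Q0.
  by rewrite coef_map_id0 ?coef0 => [/eqP//|]; exact: meval0.
have rootQ j y : X y -> root (Q j (coord_proj B y)) (y j).
  (* [L] is a polynomial on the whole ambient space; it vanishes on the image, hence on the closure,
     so the root property also holds at points of [X] off the image. *)
  move=> Xy; pose L := (map_poly coord_lift (P j)).['X_(enum_rank j)].
  have evL z : poly_eval L z = (Q j (coord_proj B z)).[z j].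
    rewrite /poly_eval /L -horner_map /= mevalXU enum_rankK -map_poly_comp /=.
    congr (_.[_]); apply: eq_map_poly => p; exact: poly_eval_coord_lift.
  apply/rootP; rewrite -evL; apply: Xy => _ [x _ <-]; rewrite evL.
  have [_ Pj0] := Pann j.
  have := congr1 (meval (fun i => x (enum_val i))) Pj0.
  rewrite meval0 -horner_map => <-; congr (_.[_]).
  rewrite -map_poly_comp; apply: eq_map_poly => p.
  exact/esym/poly_eval_subst.
exists [set y | poly_eval g y != 0]; split.
- rewrite /zariski_open /zariski_closed; apply/seteqP; split=> [y clo|y gy0 p p0].
    by apply/negP/negPn/eqP; apply: clo => z /negP/negPn/eqP.
  exact: p0.
- have [w nz_w] : exists w, g.@[w] != 0.
    apply: contrapT => /forallNP g0; case/eqP: nz_g; apply: mpoly_vanish => w.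
    by apply/eqP/negPn/negP/g0.
  exists (fun b => w (enum_rank b)); by rewrite /= (@poly_eval_rank _ _ g w).
move=> y /= nz_gy.
have /choice[s rs] : forall j, exists s : seq K, forall x, root (Q j y) x -> x \in s.
  by move=> j; apply/roots_finite/nzQ.
pose N := \max_j size (s j).
pose F (h : {ffun J -> 'I_N}) j := nth 0 (s j) (h j).
apply: (@sub_finite_set _ _ (range F)); last exact: finite_image.
move=> x [Xx xy]; have xs j : x j \in s j by apply: rs; rewrite -xy; apply: rootQ.
have lt_index j : (index (x j) (s j) < N)%N.
  by apply: leq_trans (leq_bigmax j); rewrite index_mem.
exists [ffun j => Ordinal (lt_index j)] => //; apply/funext => j.
by rewrite /F ffunE /= nth_index.
Qed.

Lemma basis_parametrized :
  algebraic_matroid_basis X B <-> alg_indep subfamily.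
Proof.
split=> [[_ /dominant_proj_parametrized]//|indep].
by split; [apply: generically_finite_parametrized | apply/dominant_proj_parametrized].
Qed.

Definition indep_gradients (x : I -> K) := forall v : J -> K,
  (forall i, \sum_(j in B) v j * poly_eval (phi j)^`M(enum_rank i) x = 0) ->
  {in B, forall j, v j = 0}.

Lemma indep_gradients_subfamily x (w := fun i => x (enum_val i)) :
  indep_gradients x <-> grad_free subfamily w.
Proof.
have sumB (v : J -> K) i :
    \sum_(j in B) v j * poly_eval (phi j)^`M(enum_rank i) x =
    \sum_k v (val (enum_val k)) * ((subfamily k)^`M(enum_rank i)).@[w].
  rewrite big_sub; exact: (reindex _ (onW_bij _ (@enum_val_bij {: {j | j \in B}}))).
split=> [free v v0 k|free v v0 j jB].
  pose u j := if insub j is Some b then v (enum_rank (b : {j | j \in B})) else 0.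
  have uE (k' : 'I_#|{: {j | j \in B}}|) : u (val (enum_val k')) = v k'.
    by rewrite /u valK enum_valK.
  rewrite -uE; apply: free (valP (enum_val k)) => i; rewrite sumB -[RHS](v0 (enum_rank i)).
  by apply: eq_bigr => l _; rewrite uE.
have := free (fun k => v (val (enum_val k))) _ (enum_rank (exist _ j jB)).
rewrite enum_rankK; apply => i; rewrite -(enum_valK i) -[RHS](v0 (enum_val i)).
by rewrite sumB.
Qed.

Lemma basis_indep_gradients (g : {mpoly K[#|I|]}) :
  g != 0 -> algebraic_matroid_basis X B ->
  exists2 x, poly_eval g x != 0 & indep_gradients x.
Proof.
move=> nz_g /basis_parametrized /(alg_indep_grad_free cardBI nz_g)[w nz_gw free].
exists (fun i => w (enum_rank i)); first by rewrite (@poly_eval_rank _ _ g w).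
apply/indep_gradients_subfamily => v v0; apply: free => j; rewrite -[RHS](v0 j).
by apply: eq_bigr => k _; congr (_ * _); apply: meval_eq => i; rewrite enum_valK.
Qed.

Lemma indep_gradients_basis x : indep_gradients x -> algebraic_matroid_basis X B.
Proof.
move=> /indep_gradients_subfamily /(grad_free_alg_indep cardBI) indep.
exact/basis_parametrized.
Qed.

End ParametrizedVariety.

(** Evaluation replaces substitution, so that relabelling can be argued on points instead of on
    variables numbered by an enumeration. *)
Lemma alg_indep_pointwise (K : numFieldType) (I J : finType)
    (phi : J -> {mpoly K[#|I|]}) (B : {set J}) :
  alg_indep (subfamily phi (B := B)) <->
  forall p, (forall x, poly_eval p (coord_proj B (parametrization phi x)) = 0) ->
    p = 0.
Proof.
split=> indep p p0; apply: indep.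
  apply: mpoly_vanish => w; pose x i := w (enum_rank i).
  by rewrite -(poly_eval_rank (z := x)) // poly_eval_subst -[RHS](p0 x).
by move=> x; have := poly_eval_subst (subfamily phi (B := B)) p x; rewrite p0 [LHS]meval0.
Qed.

(** Renaming variables turns a relation among the faces of [s @: B] into one among those of [B],
    after the parameters are moved by [t']. *)
Lemma basis_relabel (K : numFieldType) (I J : finType) (phi : J -> {mpoly K[#|I|]})
    (s s' : J -> J) (t t' : I -> I) (B : {set J}) :
  cancel s s' -> cancel t t' -> #|B| = #|I| ->
  (forall x j, parametrization phi x (s j) = parametrization phi (x \o t) j) ->
  algebraic_matroid_basis (parametrized_variety phi) B ->
  algebraic_matroid_basis (parametrized_variety phi) [set s j | j in B]%SET.
Proof.
move=> sK tK cardB equiv /(basis_parametrized phi cardB)/alg_indep_pointwise indep.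
apply/basis_parametrized; first by rewrite card_imset //; exact: can_inj sK.
have sB (b : {j | j \in B}) : s (val b) \in [set s j | j in B]%SET.
  exact/imset_f/(valP b).
have s'B (b : {j | j \in [set s j | j in B]%SET}) : s' (val b) \in B.
  by have /imsetP[j jB ->] := valP b; rewrite sK.
apply/alg_indep_pointwise => p p0.
pose r b : {j | j \in B} := exist (fun j => j \in B) _ (s'B b).
pose q := msubst (fun k => 'X_(enum_rank (r (enum_val k)))) p.
have evq z : poly_eval q z = poly_eval p (z \o r).
  rewrite /poly_eval rmorph_mmap; apply: eq_mmap => [a|k] /=; first exact: mevalC.
  by rewrite mevalXU enum_rankK.
have q0 : q = 0.
  apply: indep => x; rewrite evq -[RHS](p0 (x \o t')); apply: meval_eq => k.
  have /imsetP[j jB ej] := valP (enum_val k).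
  rewrite /coord_proj /= ej equiv; congr (parametrization phi _ _); last by rewrite sK.
  by apply/funext => i /=; rewrite tK.
apply: mpoly_vanish => w; pose z (b : {j | j \in B}) := w (enum_rank (exist (fun j => j \in [set s j | j in B]%SET) _ (sB b))).
have := evq z; rewrite q0 [LHS]meval0 => /esym z0.
rewrite -[RHS]z0; apply: meval_eq => k; rewrite /z.
rewrite -[LHS]/(w k) -{1}(enum_valK k); congr (w (enum_rank _)).
by apply/val_inj => /=; have /imsetP[j jB ->] := valP (enum_val k); rewrite sK.
Qed.

(** * Determinants over lists of ring operations *)

(** Bare operations without axioms, so that one program both computes and can be related across
    different carriers. *)
Record ops (T : Type) := Ops {
  op0 : T; op1 : T; opN : T -> T; opD : T -> T -> T; opM : T -> T -> T }.

Lemma ltbE i j : Nat.ltb i j = (i < j)%N.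
Proof. by elim: i j => [|i IHi] [|j] //; apply: IHi. Qed.

Lemma eqbE i j : Nat.eqb i j = (i == j).
Proof. by elim: i j => [|i IHi] [|j] //; apply: IHi. Qed.

Section DetOps.
Variables (T : Type) (o : ops T).

Fixpoint sum_ops (n : nat) (f : nat -> T) : T :=
  if n is m.+1 then opD o (sum_ops m f) (f m) else op0 o.

Fixpoint det_ops (n : nat) (M : nat -> nat -> T) : T :=
  if n is m.+1 then
    sum_ops n (fun j =>
      let c := opM o (M 0%N j)
                 (det_ops m (fun a b => M a.+1 (if Nat.ltb b j then b else b.+1))) in
      if odd j then opN o c else c)
  else op1 o.

Definition bordered (d : nat -> nat -> T) (l l' : seq nat) (i j : nat) : T :=
  match i, j with
  | 0, 0 => op0 o
  | 0, _.+1 | _.+1, 0 => op1 o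
  | a.+1, b.+1 => d (nth 0%N l a) (nth 0%N l' b)
  end.

(* For l = l' this is the Cayley-Menger determinant of the points l; in general
   it is, up to sign, a minor of that of the points occurring in l or l'. *)
Definition cm_minor d l l' : T := det_ops (size l).+1 (bordered d l l').

Definition cm d l := cm_minor d l l.

Lemma det_opsS n M : det_ops n.+1 M =
  sum_ops n.+1 (fun j =>
    let c := opM o (M 0%N j)
               (det_ops n (fun a b => M a.+1 (if Nat.ltb b j then b else b.+1))) in
    if odd j then opN o c else c).
Proof. by []. Qed.

Lemma eq_det_ops n (M N : nat -> nat -> T) :
  (forall i j, (i < n)%N -> (j < n)%N -> M i j = N i j) -> det_ops n M = det_ops n N.
Proof.
elim: n M N => // n IHn M N eMN; rewrite !det_opsS.
have esum k f g : (forall j, (j < k)%N -> f j = g j) -> sum_ops k f = sum_ops k g.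
  elim: k => //= k IHk efg; rewrite efg // IHk // => j ltjk; apply: efg.
  exact: ltnW.
apply: esum => j ltjn; rewrite eMN //=.
rewrite (IHn _ (fun a b => N a.+1 (if Nat.ltb b j then b else b.+1))) // => a b lta ltb.
by apply: eMN; rewrite ?ltnS //; case: Nat.ltb; rewrite // ltnW.
Qed.

End DetOps.

Definition ops_rel (T U : Type) (o : ops T) (o' : ops U) (r : T -> U -> Prop) :=
  [/\ r (op0 o) (op0 o'), r (op1 o) (op1 o'),
      forall a b, r a b -> r (opN o a) (opN o' b),
      forall a b c d, r a b -> r c d -> r (opD o a c) (opD o' b d) &
      forall a b c d, r a b -> r c d -> r (opM o a c) (opM o' b d)].

(** Parametricity of the determinant program. It yields evaluation of polynomials, first
    derivatives, reduction modulo 3 and the passage from the integers to [K]. *)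
Lemma cm_minor_rel T U (o : ops T) (o' : ops U) r d d' l l' :
  ops_rel o o' r -> (forall i j, r (d i j) (d' i j)) ->
  r (cm_minor o d l l') (cm_minor o' d' l l').
Proof.
move=> [r0 r1 rN rD rM] rd; rewrite /cm_minor.
have rsum n f f' : (forall j, r (f j) (f' j)) -> r (sum_ops o n f) (sum_ops o' n f').
  by move=> rf; elim: n => //= n IHn; apply: rD.
have rdet n M M' : (forall i j, r (M i j) (M' i j)) -> r (det_ops o n M) (det_ops o' n M').
  elim: n M M' => //= n IHn M M' rMM.
  have rterm j : r (opM o (M 0%N j) (det_ops o n (fun a b => M a.+1 (if Nat.ltb b j then b else b.+1))))
      (opM o' (M' 0%N j) (det_ops o' n (fun a b => M' a.+1 (if Nat.ltb b j then b else b.+1)))).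
    by apply: rM => //; apply: IHn.
  by apply: rD; [apply: rsum => j|]; case: odd => //; apply: rN.
by apply: rdet => -[|i] [|j] //=.
Qed.

Definition ring_ops (R : comNzRingType) : ops R :=
  Ops 0 1 (@GRing.opp R) (@GRing.add R) (@GRing.mul R).

(** Dual numbers a + b eps with eps^2 = 0; computing over them is forward differentiation. *)
Definition dual_ops T (o : ops T) : ops (T * T) :=
  Ops (op0 o, op0 o) (op1 o, op0 o) (fun a => (opN o a.1, opN o a.2))
    (fun a b => (opD o a.1 b.1, opD o a.2 b.2))
    (fun a b => (opM o a.1 b.1, opD o (opM o a.1 b.2) (opM o a.2 b.1))).

Section DetRing.
Variable R : comNzRingType.

Lemma det_ops_ring n (M : nat -> nat -> R) :
  det_ops (ring_ops R) n M = \det (\matrix_(i < n, j < n) M i j).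
Proof.
elim: n M => [|n IHn] M; first by rewrite det_mx00.
have sumE k (f : nat -> R) : sum_ops (ring_ops R) k f = \sum_(i < k) f i.
  by elim: k => [|k IHk]; rewrite ?big_ord0 // big_ord_recr /= IHk.
rewrite (expand_det_row _ ord0) det_opsS sumE.
apply: eq_bigr => j _; rewrite mxE /cofactor add0n /= IHn.
have -> : row' ord0 (col' j (\matrix_(i < n.+1, k < n.+1) M i k)) =
    \matrix_(a < n, b < n) M a.+1 (if Nat.ltb b j then b : nat else b.+1).
  apply/matrixP => a b; rewrite !mxE /= /bump ltbE; congr (M _ _).
  by case: (ltnP b j).
rewrite -signr_odd; case: odd => /=; last by rewrite expr0 mul1r.
by rewrite expr1 mulN1r mulrN.
Qed.

(** Reordering the points permutes rows and columns simultaneously and fixes the border, so the sign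
    of the permutation enters twice. *)
Lemma cm_perm d l l' : perm_eq l l' -> cm (ring_ops R) d l = cm (ring_ops R) d l'.
Proof.
move=> ell; rewrite /cm /cm_minor (perm_size ell); set n := size l'.
have /tuple_permP[p ep] : perm_eq l (in_tuple l') by [].
rewrite !det_ops_ring; set A := (X in _ = \det X).
pose q := lift_perm ord0 ord0 p.
transitivity (\det (row_perm q (col_perm q A))); last first.
  rewrite row_permE col_permE !det_mulmx !det_perm odd_permV mulrCA.
  by rewrite -expr2 sqrr_sign mulr1.
congr (\det _); apply/matrixP => i j; rewrite !mxE.
have nth_l (a : 'I_n) : nth 0%N l a = nth 0%N l' (p a).
  by rewrite ep -tnth_nth tnth_mktuple (tnth_nth 0%N).
case: (unliftP ord0 i) => [a|] ->; case: (unliftP ord0 j) => [b|] ->.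
- by rewrite !lift_perm_lift /= !nth_l.
- by rewrite lift_perm_lift lift_perm_id.
- by rewrite lift_perm_lift lift_perm_id.
- by rewrite lift_perm_id.
Qed.

End DetRing.

(** * Heron polynomials *)

Section HeronPolynomials.
Variables (K : numFieldType) (n : nat).
Implicit Types (S : {set 'I_n.+1}) (x v : edge n -> K).

Definition points S : seq nat := [seq val i | i <- enum S].

Definition dist x (i j : nat) : K := sqdist x (inord i) (inord j).

Definition cm_scale (k : nat) : K :=
  (-1) ^+ k.-1.+1 / ((k.-1)`!%:R ^+ 2 * 2 ^+ k.-1).

Lemma cm_scale_neq0 k : cm_scale k != 0.
Proof.
rewrite mulf_neq0 ?signr_eq0 // invr_neq0 // mulf_neq0 // expf_neq0 //.
  by rewrite pnatr_eq0 -lt0n fact_gt0.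
by rewrite pnatr_eq0.
Qed.

Lemma cayley_mengerE x S :
  cayley_menger x S = cm_scale #|S| * cm (ring_ops K) (dist x) (points S).
Proof.
rewrite /cayley_menger /cm /cm_minor size_map -cardE det_ops_ring.
congr (_ * \det _); apply/matrixP => i j; rewrite [RHS]mxE.
have nthS (a : 'I_#|S|) : inord (nth 0%N (points S) a) = enum_val a.
  rewrite (nth_map (enum_default a)); last by rewrite -cardE.
  by rewrite inord_val.
rewrite -(splitK i) -(splitK j).
case: (split i) => a; case: (split j) => b /=.
- by rewrite block_mxEul mxE !ord1.
- by rewrite block_mxEur mxE !ord1.
- by rewrite block_mxEdl mxE !ord1.
- by rewrite block_mxEdr mxE /= /dist !nthS.
Qed.

Definition var_dist (i j : nat) : {mpoly K[#|edge n|]} :=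
  if insub [set inord i; inord j]%SET is Some e then 'X_(enum_rank (e : edge n)) else 0.

Definition heron_poly (S : face n) : {mpoly K[#|edge n|]} :=
  cm_scale #|val S| *: cm (ring_ops {mpoly K[#|edge n|]}) var_dist (points (val S)).

(* Pairs (value, derivative along v) at x multiply like dual numbers. *)
Definition derivation x v (p : {mpoly K[#|edge n|]}) : K :=
  \sum_e v e * poly_eval p^`M(enum_rank e) x.

Definition first_jet x v p (a : K * K) := poly_eval p x = a.1 /\ derivation x v p = a.2.

Lemma derivationM x v p q : derivation x v (p * q) =
  derivation x v p * poly_eval q x + poly_eval p x * derivation x v q.
Proof.
rewrite /derivation mulr_suml mulr_sumr -big_split; apply: eq_bigr => e _.
by rewrite mderivM /poly_eval mevalD !mevalM /=; ring.
Qed.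

Lemma derivationZ x v a p : derivation x v (a *: p) = a * derivation x v p.
Proof.
rewrite /derivation mulr_sumr; apply: eq_bigr => e _.
by rewrite mderivZ /poly_eval mevalZ mulrCA.
Qed.

Lemma derivation_comb x (I : finType) (c : I -> K) (w : I -> edge n -> K) p :
  derivation x (fun e => \sum_k c k * w k e) p = \sum_k c k * derivation x (w k) p.
Proof.
rewrite /derivation; under eq_bigr => e _ do rewrite mulr_suml.
rewrite exchange_big; apply: eq_bigr => k _; rewrite mulr_sumr.
by apply: eq_bigr => e _; rewrite mulrA.
Qed.

Lemma first_jet_ops x v :
  ops_rel (ring_ops {mpoly K[#|edge n|]}) (dual_ops (ring_ops K)) (first_jet x v).
Proof.
split; rewrite /first_jet /=.
- by split; [exact: meval0 | apply: big1 => e _; rewrite mderiv0 [poly_eval _ _]meval0 mulr0].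
- split; [exact: meval1 | apply: big1 => e _].
  by rewrite (_ : 1 = 1%:MP) // mderivC [poly_eval _ _]meval0 mulr0.
- move=> p a [<- <-]; split; first exact: mevalN.
  by rewrite -sumrN; apply: eq_bigr => e _; rewrite mderivN [poly_eval _ _]mevalN mulrN.
- move=> p a q b [<- <-] [<- <-]; split; first exact: mevalD.
  rewrite -big_split; apply: eq_bigr => e _.
  by rewrite mderivD [poly_eval _ _]mevalD mulrDr.
- move=> p a q b [<- <-] [<- <-]; split; first exact: mevalM.
  by rewrite derivationM addrC.
Qed.

Lemma first_jet_var x v i j : first_jet x v (var_dist i j) (dist x i j, dist v i j).
Proof.
rewrite /first_jet /var_dist /dist /sqdist /=; case: insub => [e|]; last first.
  by split; [exact: meval0 | apply: big1 => e _; rewrite mderiv0 [poly_eval _ _]meval0 mulr0].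
split; first by rewrite /poly_eval mevalXU enum_rankK.
rewrite /derivation (bigD1 e) //= big1 => [|e' /negPf ne].
  rewrite mderivX mnm1E eqxx scale1r.
  have -> : (U_(enum_rank e) - U_(enum_rank e))%MM = 0%MM :> 'X_{1..#|edge n|}.
    by apply/mnmP => k; rewrite mnmBE subnn mnm0E.
  by rewrite mpolyX0 [poly_eval _ _]meval1 mulr1 addr0.
rewrite mderivX mnm1E (inj_eq enum_rank_inj) eq_sym ne scale0r.
by rewrite [poly_eval _ _]meval0 mulr0.
Qed.

Definition cm_poly l l' := cm_minor (ring_ops {mpoly K[#|edge n|]}) var_dist l l'.

Lemma first_jet_cm x v l l' : first_jet x v (cm_poly l l')
  (cm_minor (dual_ops (ring_ops K)) (fun i j => (dist x i j, dist v i j)) l l').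
Proof. by apply: cm_minor_rel; [apply: first_jet_ops | apply: first_jet_var]. Qed.

Lemma poly_eval_cm x l l' :
  poly_eval (cm_poly l l') x = cm_minor (ring_ops K) (dist x) l l'.
Proof.
apply: (cm_minor_rel (r := fun p a => poly_eval p x = a)) => [|i j]; last first.
  by have [] := first_jet_var x x i j.
split=> //=; [exact: meval0 | exact: meval1 | by move=> p _ <-; exact: mevalN | | ].
  by move=> p _ q _ <- <-; exact: mevalD.
by move=> p _ q _ <- <-; exact: mevalM.
Qed.

Lemma heron_polyE x (S : face n) : poly_eval (heron_poly S) x = heron_map x S.
Proof. by rewrite /heron_map cayley_mengerE -[cm _ _ _]poly_eval_cm -mevalZ. Qed.

Lemma heron_varietyE : @heron_variety K n = parametrized_variety heron_poly.
Proof.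
congr zariski_closure; congr image; apply/funext => x; apply/funext => S.
by rewrite -heron_polyE.
Qed.

Lemma edge_act_subproof (s : 'S_n.+1) (e : edge n) : #|s @: val e| == 2%N.
Proof. by rewrite card_imset ?(valP e) //; apply: perm_inj. Qed.

Definition edge_act (s : 'S_n.+1) (e : edge n) : edge n :=
  exist _ (s @: val e)%SET (edge_act_subproof s e).

Lemma edge_actK s : cancel (edge_act s) (edge_act s^-1).
Proof.
move=> e; apply: val_inj; rewrite /= -imset_comp.
by rewrite (eq_imset _ (permK s)) imset_id.
Qed.

Lemma sqdist_perm x (s : 'S_n.+1) i j : sqdist x (s i) (s j) = sqdist (x \o edge_act s) i j.
Proof.
rewrite /sqdist; have eS : [set s i; s j]%SET = (s @: [set i; j])%SET.
  by rewrite imsetU !imset_set1.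
rewrite eS; case: (insubP _ [set i; j]%SET) => [e cij eij|ncij]; last first.
  by rewrite insubN // card_imset //; apply: perm_inj.
rewrite -eij (_ : insub _ = Some (edge_act s e)) //.
exact: (valK (edge_act s e)).
Qed.

(** The image of an increasing list of points need not be increasing; [cm_perm] absorbs the
    reordering. *)
Lemma heron_map_perm x (s : 'S_n.+1) (S : face n) :
  heron_map x (face_act S s) = heron_map (x \o edge_act s) S.
Proof.
rewrite /heron_map !cayley_mengerE /= card_imset; last exact: perm_inj.
have /cm_perm-> : perm_eq (points (s @: val S)%SET) [seq val (s i) | i <- enum (val S)].
  rewrite (map_comp val); apply/perm_map/uniq_perm.
  - exact: enum_uniq.
  - by rewrite map_inj_uniq ?enum_uniq //; apply: perm_inj.
  move=> i; rewrite mem_enum; apply/imsetP/mapP => -[j jS ->]; exists j => //.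
    by rewrite mem_enum.
  by rewrite mem_enum in jS.
congr (_ * _); rewrite /cm /cm_minor !size_map; apply: eq_det_ops.
have nthS (a : 'I_#|val S|) : inord (nth 0%N [seq val (s i) | i <- enum (val S)] a) =
    s (inord (nth 0%N (points (val S)) a)).
  by rewrite !(nth_map (enum_default a)) -?cardE // !inord_val.
rewrite -cardE => -[|i] [|j] //; rewrite !ltnS => lti ltj /=.
by rewrite /dist (nthS (Ordinal lti)) (nthS (Ordinal ltj)) sqdist_perm.
Qed.

End HeronPolynomials.

(** * Rank bounds *)

Section RankBounds.
Variables (K : numFieldType) (n : nat).
Implicit Types (x v : edge n -> K) (A B Q : {set face n}).

Notation indep_at x B := (indep_gradients (@heron_poly K n) B x).

Lemma indep_atP x B : indep_at x B <->
  forall c : face n -> K,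
    (forall v, \sum_(S in B) c S * derivation x v (heron_poly K S) = 0) ->
    {in B, forall S, c S = 0}.
Proof.
split=> [free c c0|free c c0].
  apply: free => e; rewrite -[RHS](c0 (fun f => (f == e)%:R)).
  apply: eq_bigr => S _; congr (_ * _); rewrite /derivation (bigD1 e) //= eqxx mul1r.
  by rewrite big1 ?addr0 // => f /negPf ->; rewrite mul0r.
apply: free => v; rewrite /derivation.
under eq_bigr => S _ do rewrite mulr_sumr.
rewrite exchange_big big1 // => e _; under eq_bigr => S _ do rewrite mulrCA.
by rewrite -mulr_sumr c0 mulr0.
Qed.

Lemma indep_atS x A B : A \subset B -> indep_at x B -> indep_at x A.
Proof.
move=> sAB /indep_atP free; apply/indep_atP => c c0 S SA.
pose c' T := if T \in A then c T else 0.
have := free c' _ S (fintype.subsetP sAB S SA); rewrite /c' SA; apply=> v.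
rewrite -[RHS](c0 v) (big_setID A) /= (finset.setIidPr sAB) [X in _ + X]big1 ?addr0.
  by apply: eq_bigr => T ->.
by move=> T; rewrite inE => /andP[/negPf-> _]; rewrite mul0r.
Qed.

Definition free_family (I : finType) d (w : 'I_d -> I -> K) :=
  forall a : 'I_d -> K, (forall i, \sum_k a k * w k i = 0) -> forall k, a k = 0.

Lemma free_family_rank (I : finType) d (w : 'I_d -> I -> K) :
  free_family w -> \rank (\matrix_(k < d, j < #|I|) w k (enum_val j)) = d.
Proof.
move=> free; apply/eqP; rewrite -/(row_free _) -kermx_eq0; apply/rowV0P => r.
rewrite sub_kermx => /eqP rM; apply/rowP => k; rewrite mxE; apply: (free (r 0)) => i.
have /rowP/(_ (enum_rank i)) := rM; rewrite !mxE => rMi.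
by rewrite -[RHS]rMi; apply: eq_bigr => l _; rewrite !mxE enum_rankK.
Qed.

(** The gradients form a matrix of rank [#|B|], the directions one of rank [d], and the first times
    the transpose of the second is zero; so the ranks add up to at most the number of columns. *)
Lemma indep_at_card x B d (w : 'I_d -> edge n -> K) :
  indep_at x B -> free_family w ->
  (forall k, {in B, forall S, derivation x (w k) (heron_poly K S) = 0}) ->
  (#|B| + d <= #|edge n|)%N.
Proof.
move=> /indep_atP freeB /free_family_rank rw orth.
pose G (l : 'I_#|B|) e := poly_eval (heron_poly K (enum_val l))^`M(enum_rank e) x.
have /free_family_rank rG : free_family G.
  move=> a a0 l; pose c S := \sum_(k | enum_val k == S) a k.
  have cE k : c (enum_val k) = a k.
    by rewrite /c (big_pred1 k) // => k'; rewrite (inj_eq enum_val_inj).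
  rewrite -cE; apply: freeB (enum_valP l) => v.
  rewrite big_enum_val /derivation.
  under eq_bigr => k _ do rewrite cE mulr_sumr.
  rewrite exchange_big big1 // => e _; under eq_bigr => k _ do rewrite mulrCA.
  by rewrite -mulr_sumr a0 mulr0.
have GW0 : (\matrix_(l < #|B|, j < #|edge n|) G l (enum_val j)) *m
    (\matrix_(k < d, j < #|edge n|) w k (enum_val j))^T = 0.
  apply/matrixP => l k; rewrite !mxE.
  rewrite -[RHS](orth k (enum_val l) (enum_valP l)) /derivation.
  rewrite [RHS](reindex _ (onW_bij _ (@enum_val_bij (edge n)))) /=.
  by apply: eq_bigr => j _; rewrite !mxE mulrC.
by have := mulmx0_rank_max GW0; rewrite mxrank_tr rG rw.
Qed.

(* At the points where g does not vanish, the gradients of the faces in Q span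
   a space of dimension at most r. *)
Definition rank_at_most Q r := exists2 g : {mpoly K[#|edge n|]}, g != 0 &
  forall x B, poly_eval g x != 0 -> B \subset Q -> indep_at x B -> (#|B| <= r)%N.

Lemma rank_at_most_nonbasis Q r B :
  rank_at_most Q r -> #|B| = #|edge n| -> (r < #|B :&: Q|)%N ->
  ~ algebraic_matroid_basis (@heron_variety K n) B.
Proof.
move=> [g nz_g leQ] cardB ltr; rewrite heron_varietyE => basisB.
have [x nz_gx indep] := basis_indep_gradients cardB nz_g basisB.
have := leQ x (B :&: Q) nz_gx (finset.subsetIr _ _) (indep_atS (finset.subsetIl _ _) indep).
by rewrite leqNgt ltr.
Qed.

End RankBounds.

Notation indep_at x B := (indep_gradients (@heron_poly _ _) B x).

(** * Vector fields and flats *)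

Section Points.
Variable n : nat.
Implicit Types S : {set 'I_n.+1}.

Lemma mem_points S (i : 'I_n.+1) : (val i \in points S) = (i \in S).
Proof. by rewrite (mem_map val_inj) mem_enum. Qed.

Lemma points_inj : injective (@points n).
Proof. by move=> S T eST; apply/setP => i; rewrite -!mem_points eST. Qed.

Lemma points_lt S i : i \in points S -> (i < n.+1)%N.
Proof. by case/mapP => j _ ->; apply: ltn_ord. Qed.

Definition set_of_seq (l : seq nat) : {set 'I_n.+1} := [set i | val i \in l].

Lemma points_filter (p : pred nat) :
  points [set i : 'I_n.+1 | p (val i)] = [seq i <- iota 0 n.+1 | p i].
Proof.
rewrite -val_enum_ord filter_map /points; congr map.
by rewrite enumT; apply: eq_filter => i; rewrite /= inE.
Qed.

Lemma points_set_of_seq l : points (set_of_seq l) = [seq i <- iota 0 n.+1 | i \in l].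
Proof. exact: points_filter. Qed.

Lemma face_ex l : l = [seq i <- iota 0 n.+1 | i \in l] -> (2 <= size l)%N ->
  exists S : face n, points (val S) = l.
Proof.
move=> el szl; have pl : points (set_of_seq l) = l by rewrite points_set_of_seq -el.
have cl : (2 <= #|set_of_seq l|)%N by rewrite cardE -(size_map val) [map _ _]pl.
by exists (exist (fun S : {set 'I_n.+1} => (2 <= #|S|)%N) _ cl).
Qed.

Lemma edge_ex l : l = [seq i <- iota 0 n.+1 | i \in l] -> size l = 2 ->
  exists e : edge n, points (val e) = l.
Proof.
move=> el szl; have pl : points (set_of_seq l) = l by rewrite points_set_of_seq -el.
have cl : #|set_of_seq l| == 2 by rewrite cardE -(size_map val) [map _ _]pl szl.
by exists (exist (fun S : {set 'I_n.+1} => #|S| == 2) _ cl).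
Qed.

End Points.

(** Only entries above the diagonal are read: symmetry and the zero diagonal hold by reduction, and
    [ring] sees ten free variables for five points. *)
Definition sym_ext (R : nzRingType) (X : nat -> nat -> R) i j : R :=
  if Nat.ltb i j then X i j else if Nat.ltb j i then X j i else 0.

Section VectorFields.
Variables (K : numFieldType) (n : nat).
Implicit Types (x v : edge n -> K) (X u : nat -> nat -> K).

Definition field u : edge n -> K :=
  fun e => u (nth 0%N (points (val e)) 0) (nth 0%N (points (val e)) 1).

Lemma points_pair (i j : nat) : (i < j)%N -> (j < n.+1)%N ->
  points ([set inord i; inord j]%SET : {set 'I_n.+1}) = [:: i; j].
Proof.
move=> ltij ltj; have lti := ltn_trans ltij ltj.
have -> : [set inord i; inord j]%SET = set_of_seq n [:: i; j].
  by apply/setP => k; rewrite !inE -!val_eqE /= !inordK.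
rewrite points_set_of_seq.
apply: (irr_sorted_eq ltn_trans ltnn); first exact/(sorted_filter ltn_trans)/iota_ltn_sorted.
  by rewrite /= ltij.
move=> k; rewrite mem_filter mem_iota /= add0n !inE.
by case: eqP => [->|_]; [rewrite lti | case: eqP => [->|]; [rewrite ltj|]].
Qed.

Lemma var_dist_sym_ext i j : var_dist K n i j = sym_ext (var_dist K n) i j.
Proof.
rewrite /sym_ext !ltbE; case: (ltngtP i j) => // [_|->].
  by rewrite /var_dist finset.setUC.
by rewrite /var_dist finset.setUid insubN // cards1.
Qed.

Lemma distC x i j : dist x i j = dist x j i.
Proof. by rewrite /dist /sqdist finset.setUC. Qed.

Lemma dist_diag x i : dist x i i = 0.
Proof. by rewrite /dist /sqdist finset.setUid insubN // cards1. Qed.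

Lemma dist_sym_ext x i j : dist x i j = sym_ext (dist x) i j.
Proof.
rewrite /sym_ext !ltbE; case: (ltngtP i j) => // [_|->]; first exact: distC.
exact: dist_diag.
Qed.

Lemma dist_field u i j : (i < n.+1)%N -> (j < n.+1)%N ->
  dist (field u) i j = sym_ext u i j.
Proof.
have lt_case a b : (a < b)%N -> (b < n.+1)%N -> dist (field u) a b = u a b.
  move=> ltab ltb; rewrite /dist /sqdist.
  have cab : #|([set inord a; inord b]%SET : {set 'I_n.+1})| == 2.
    by rewrite cards2 -val_eqE /= !inordK ?(ltn_trans ltab) // neq_ltn ltab.
  by rewrite insubT /= /field /= points_pair.
move=> lti ltj; rewrite /sym_ext !ltbE; case: (ltngtP i j) => [ltij|ltji|->].
- exact: lt_case.
- by rewrite distC lt_case.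
- exact: dist_diag.
Qed.

Lemma eq_cm_minor T (o : ops T) (d d' : nat -> nat -> T) l l' : size l = size l' ->
  {in l & l', forall i j, d i j = d' i j} -> cm_minor o d l l' = cm_minor o d' l l'.
Proof.
move=> esz edd; apply: eq_det_ops => -[|i] [|j] //; rewrite !ltnS => lti ltj /=.
by apply: edd; rewrite mem_nth // -esz.
Qed.

Definition jet X u := cm_minor (dual_ops (ring_ops K)) (fun i j => (sym_ext X i j, sym_ext u i j)).

Definition inrange (l : seq nat) := all (fun i => i < n.+1)%N l.

Lemma derivation_jet x u l l' : size l = size l' -> inrange l -> inrange l' ->
  derivation x (field u) (cm_poly K n l l') = (jet (dist x) u l l').2.
Proof.
move=> esz /allP rl /allP rl'; have [_ ->] := first_jet_cm x (field u) l l'.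
congr (snd _); apply: eq_cm_minor => // i j il jl; rewrite -dist_sym_ext.
by rewrite (dist_field _ (rl _ il) (rl' _ jl)).
Qed.

Lemma derivation_heron x v (S : face n) :
  derivation x v (heron_poly K S) =
  cm_scale K #|val S| * derivation x v (cm_poly K n (points (val S)) (points (val S))).
Proof. exact: derivationZ. Qed.

(* Moving the point a in the direction p_1 - p_0 with unit speed changes
   |p_a - p_i|^2 at the rate 2 (p_a - p_i).(p_1 - p_0), which is the following
   up to sign; the squared volume of a simplex with vertices p_0, p_1, p_a, ...
   is constant along this motion. *)
Definition shear X (a i j : nat) : K :=
  let d := sym_ext X in
  if Nat.eqb i a then d a 1%N - d a 0%N + d j 0%N - d j 1%N
  else if Nat.eqb j a then d a 1%N - d a 0%N + d i 0%N - d i 1%N else 0.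

End VectorFields.

(** The list of constants unfolds the determinant program but leaves the ring operations folded for
    [ring]. *)
Ltac cm_ring := cbv beta iota zeta delta [
  jet cm cm_minor det_ops sum_ops bordered sym_ext dual_ops ring_ops
  op0 op1 opN opD opM shear nth size rcons odd negb Nat.ltb Nat.leb Nat.eqb fst snd]; ring.

Section ShearInvariance.
Variables (K : numFieldType) (X : nat -> nat -> K).

Lemma jet_shear l a : a \in [:: 2; 3; 4]%N ->
  l \in [:: [:: 0; 1]; [:: 0; 1; 2]; [:: 0; 1; 3]; [:: 0; 1; 4]; [:: 0; 1; 2; 3];
    [:: 0; 1; 2; 4]; [:: 0; 1; 3; 4]; [:: 0; 1; 2; 3; 4]]%N ->
  (jet X (shear X a) l l).2 = 0.
Proof.
rewrite !inE => /or3P[] /eqP-> lA;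
  repeat (case/orP: lA => [/eqP->|lA]; first by cm_ring); move/eqP: lA => ->; cm_ring.
Qed.

End ShearInvariance.

Lemma card_edge4 : #|edge 4| = 10%N.
Proof.
have := card_draws 'I_5 2%N; rewrite card_ord => cd; rewrite card_sig.
rewrite -[RHS]/('C(5, 2)%N) -cd.
by apply: eq_card => e; rewrite !inE.
Qed.

Definition faces_of (L : seq (seq nat)) : {set face 4} :=
  [set S : face 4 | points (val S) \in L].

Section FlatRanks.
Variable K : numFieldType.
Implicit Types (x v : edge 4 -> K) (X : nat -> nat -> K) (L : seq (seq nat)).

Lemma points_inrange (S : {set 'I_5}) : inrange 4 (points S).
Proof. by apply/allP => i /points_lt. Qed.

Lemma field_rank L r d (g : {mpoly K[#|edge 4|]})
    (u : (nat -> nat -> K) -> 'I_d -> nat -> nat -> K) :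
  (r + d = 10)%N -> g != 0 ->
  (forall x, poly_eval g x != 0 -> free_family (fun k => field (u (dist x) k) : edge 4 -> K)) ->
  (forall X k l, l \in L -> (jet X (u X k) l l).2 = 0) ->
  rank_at_most K (faces_of L) r.
Proof.
move=> rd nz_g free orth; exists g => // x B gx sBL indep.
rewrite -(leq_add2r d) rd -card_edge4; apply: (indep_at_card indep (free x gx)).
move=> k S /(fintype.subsetP sBL); rewrite inE => SL.
by rewrite derivation_heron derivation_jet ?points_inrange // orth ?mulr0.
Qed.

Lemma derivation_heron_eq0 x v (S : face 4) :
  {in points (val S) &, forall i j, dist v i j = 0} ->
  derivation x v (heron_poly K S) = 0.
Proof.
move=> v0; rewrite derivation_heron.
have [_ ->] := first_jet_cm x v (points (val S)) (points (val S)).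
rewrite (@eq_cm_minor _ _ _ (fun i j => (dist x i j, 0))) //; last first.
  by move=> i j iS jS; rewrite v0.
(* Relating to a one-element carrier turns the binary transfer lemma into an invariant: the
   derivative component stays zero. *)
pose triv := Ops tt tt (fun=> tt) (fun _ _ => tt) (fun _ _ => tt).
have := @cm_minor_rel _ _ (dual_ops (ring_ops K)) triv (fun a _ => a.2 = 0)
  (fun i j => (dist x i j, 0)) (fun _ _ => tt) (points (val S)) (points (val S)).
move=> -> //; first by rewrite mulr0.
split=> //=; [by move=> [a b] _ /= ->; rewrite oppr0 | |].
  by move=> [a b] _ [c e] _ /= -> ->; rewrite addr0.
by move=> [a b] _ [c e] _ /= -> ->; rewrite mulr0 mul0r addr0.
Qed.

Definition edge_pairs (l : seq nat) : seq (seq nat) :=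
  [seq [:: i; j] | i <- l, j <- [seq j <- l | (i < j)%N]].

(** The volumes of the faces in [L] depend only on the edges in [E], so the unit vectors of all
    other edges annihilate them. *)
Lemma edge_rank L (E : seq (seq nat)) :
  all (fun l => all (fun p => p \in E) (edge_pairs l)) L ->
  rank_at_most K (faces_of L) (size E).
Proof.
move=> /allP LE; exists 1 => [|x B _ sBL indep]; first exact: oner_neq0.
pose F : {set edge 4} := [set e | points (val e) \in E].
have leF : (#|F| <= size E)%N.
  rewrite cardE -(size_map (fun e : edge 4 => points (val e))).
  apply: uniq_leq_size => [|l /mapP[e]].
    by rewrite map_inj_uniq ?enum_uniq // => e f /points_inj/val_inj.
  by rewrite mem_enum inE => eE ->.
apply: leq_trans leF.
pose w (k : 'I_#|~: F|) e : K := (e == enum_val k)%:R.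
rewrite -(leq_add2r #|~: F|) cardsC; apply: (indep_at_card indep (w := w)).
  move=> a a0 k; rewrite -[RHS](a0 (enum_val k)) (bigD1 k) //= /w eqxx mulr1.
  rewrite big1 ?addr0 // => k' /negPf ne.
  by rewrite (inj_eq enum_val_inj) eq_sym ne mulr0.
move=> k S /(fintype.subsetP sBL); rewrite inE => /LE/allP SE.
apply: derivation_heron_eq0 => i j iS jS.
wlog ltij : i j iS jS / (i < j)%N.
  move=> IH; case: (ltngtP i j) => [ltij|ltji|->]; last exact: dist_diag.
    exact: IH.
  by rewrite distC; apply: IH.
rewrite /dist /sqdist; case: insubP => // e _ eij; rewrite /w.
case: eqP => // ee; have := enum_valP k; rewrite -ee !inE eij.
rewrite points_pair ?(points_lt jS) // => /negP[]; apply: SE.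
by apply/allpairsPdep; exists i, j; rewrite mem_filter ltij.
Qed.


End FlatRanks.

(** * Determinantal identities and the six special flats *)

Section Dodgson.
Variables (R : comNzRingType) (X : nat -> nat -> R).

Notation m l l' := (cm_minor (ring_ops R) (sym_ext X) l l').

(** Desnanot-Jacobi for the rows and columns of the points 0 and 1; by symmetry the two mixed minors
    agree. *)
Lemma dodgson01 :
  m [:: 0; 1; 2; 3; 4]%N [:: 0; 1; 2; 3; 4]%N * m [:: 2; 3; 4]%N [:: 2; 3; 4]%N =
  m [:: 0; 2; 3; 4]%N [:: 0; 2; 3; 4]%N * m [:: 1; 2; 3; 4]%N [:: 1; 2; 3; 4]%N
  - m [:: 0; 2; 3; 4]%N [:: 1; 2; 3; 4]%N ^+ 2.
Proof. by cm_ring. Qed.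

Lemma dodgson4 t :
  t \in [:: [:: 1; 2; 3]; [:: 0; 2; 3]; [:: 0; 1; 3]; [:: 0; 1; 2]]%N ->
  m [:: 0; 1; 2; 3; 4]%N [:: 0; 1; 2; 3; 4]%N * m t t =
  m (rcons t 4%N) (rcons t 4%N) * m [:: 0; 1; 2; 3]%N [:: 0; 1; 2; 3]%N
  - m [:: 0; 1; 2; 3]%N (rcons t 4%N) ^+ 2.
Proof. by rewrite !inE => /or4P[] /eqP->; cm_ring. Qed.

(** Take the rows of the border and of 0, 1, 2, 3 against all columns and repeat the border row:
    this singular 6 x 6 determinant, expanded along the repeated row, is the alternating sum. *)
Lemma cofactor_sum4 :
  m [:: 0; 1; 2; 3]%N [:: 1; 2; 3; 4]%N - m [:: 0; 1; 2; 3]%N [:: 0; 2; 3; 4]%N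
  + m [:: 0; 1; 2; 3]%N [:: 0; 1; 3; 4]%N - m [:: 0; 1; 2; 3]%N [:: 0; 1; 2; 4]%N
  + m [:: 0; 1; 2; 3]%N [:: 0; 1; 2; 3]%N = 0.
Proof. by cm_ring. Qed.

End Dodgson.

Section SpecialFlats.
Variable K : numFieldType.
Implicit Types (x v : edge 4 -> K) (X : nat -> nat -> K).

(** The factor for a = [k.+2] is the component of the shear of a at the edge 0a, namely -2 (p_a -
    p_0).(p_1 - p_0). No other shear moves this edge, so nonzero factors make the three shears
    independent. *)
Definition shear_poly : {mpoly K[#|edge 4|]} := \prod_(k < 3)
  (var_dist K 4 k.+2 1 - var_dist K 4 k.+2 0 - var_dist K 4 0 1).

Lemma poly_eval_var x i j : poly_eval (var_dist K 4 i j) x = dist x i j.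
Proof. by have [] := first_jet_var x x i j. Qed.

Lemma poly_eval_shear x : poly_eval shear_poly x =
  \prod_(k < 3) (dist x k.+2 1 - dist x k.+2 0 - dist x 0 1).
Proof.
rewrite /poly_eval rmorph_prod; apply: eq_bigr => k _.
by rewrite !rmorphB /= -!poly_eval_var.
Qed.

Lemma shear_free x : poly_eval shear_poly x != 0 ->
  free_family (fun k : 'I_3 => field (shear (dist x) k.+2) : edge 4 -> K).
Proof.
rewrite poly_eval_shear => /prodf_neq0 nz c c0 k.
have [e ek] : exists e : edge 4, points (val e) = [:: 0; k.+2]%N.
  by apply: edge_ex => //; case: k => -[|[|[|]]].
have := c0 e; rewrite (bigD1 k) //= big1 => [|l nlk].
  rewrite addr0 /field ek /= /shear /= eqbE eqxx -!dist_sym_ext dist_diag addr0.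
  move=> /eqP; rewrite mulf_eq0 => /orP[/eqP//|].
  by rewrite (negPf (nz k isT)).
rewrite /field ek /= /shear /= eqbE; case: eqP => [/val_inj ekl|]; last by rewrite mulr0.
by rewrite ekl eqxx in nlk.
Qed.

(** The regular simplex with unit edges is the witness that the polynomials cutting out degenerate
    loci are nonzero. *)
Lemma poly_eval_regular l l' : size l = size l' -> inrange 4 l -> inrange 4 l' ->
  poly_eval (cm_poly K 4 l l') (field (fun _ _ => 1)) =
  cm_minor (ring_ops K) (sym_ext (fun _ _ => 1)) l l'.
Proof.
move=> esz /allP rl /allP rl'; rewrite poly_eval_cm; apply: eq_cm_minor => // i j il jl.
by rewrite (dist_field _ (rl _ il) (rl' _ jl)).
Qed.

Lemma shear_poly_neq0 : shear_poly != 0.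
Proof.
suff : poly_eval shear_poly (field (fun _ _ => 1)) != 0.
  by apply: contraNneq => ->; rewrite [poly_eval _ _]meval0.
rewrite poly_eval_shear; apply/prodf_neq0 => -[k ltk] _.
rewrite !dist_field ?ltnS //= /sym_ext /=.
by rewrite subrr sub0r oppr_eq0 oner_eq0.
Qed.

(** The eight faces containing the segment 01; all three shears preserve them, whence the rank bound
    10 - 3. *)
Definition bone : seq (seq nat) := [:: [:: 0; 1]; [:: 0; 1; 2]; [:: 0; 1; 3]; [:: 0; 1; 4];
  [:: 0; 1; 2; 3]; [:: 0; 1; 2; 4]; [:: 0; 1; 3; 4]; [:: 0; 1; 2; 3; 4]]%N.

Lemma bone_rank : rank_at_most K (faces_of bone) 7.
Proof.
apply: (@field_rank _ _ 7 3 shear_poly (fun X k => shear X k.+2)) => //.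
- exact: shear_poly_neq0.
- exact: shear_free.
by move=> X k l; apply: jet_shear; case: k => -[|[|[|]]].
Qed.

(** The triangle 012 is untouched by the shears of 3 and 4, whence 10 - 2. *)
Definition bone_triangle : seq (seq nat) := [:: [:: 0; 2]; [:: 1; 2]]%N ++ bone.

Lemma bone_triangle_rank : rank_at_most K (faces_of bone_triangle) 8.
Proof.
apply: (@field_rank _ _ 8 2 shear_poly (fun X k => shear X k.+3)) => //.
- exact: shear_poly_neq0.
- move=> x /shear_free free c c0 k.
  pose c' (l : 'I_3) := if unlift ord0 l is Some l' then c l' else 0.
  have := free c' _ (lift ord0 k); rewrite /c' liftK; apply=> e.
  rewrite big_ord_recl /c' unlift_none mul0r add0r -[RHS](c0 e).
  by apply: eq_bigr => l _; rewrite liftK.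
move=> X k l; rewrite mem_cat => /orP[|lb]; last first.
  by apply: jet_shear lb; case: k => -[|[|]].
by rewrite !inE => /orP[]/eqP->; case: k => -[|[|k]] ltk //=; cm_ring.
Qed.

Lemma free_family_comb (I : finType) d (w : 'I_d -> I -> K) (c : 'I_d -> K) (k : 'I_d) :
  free_family w -> c k != 0 ->
  free_family (fun _ : 'I_1 => fun i => \sum_l c l * w l i).
Proof.
move=> free nz_ck a a0 l; rewrite ord1.
suff /eqP : a 0 * c k = 0 by rewrite mulf_eq0 (negPf nz_ck) orbF => /eqP.
apply: (free (fun l => a 0 * c l)) => i; have := a0 i; rewrite big_ord1 mulr_sumr => ai.
by rewrite -[RHS]ai; apply: eq_bigr => l' _; rewrite mulrA.
Qed.

(** The tetrahedron 0123 with all its faces is untouched by the shear of 4, whence 10 - 1. *)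
Definition bone_tetrahedron : seq (seq nat) :=
  [:: [:: 0; 2]; [:: 0; 3]; [:: 1; 2]; [:: 1; 3]; [:: 2; 3];
      [:: 0; 2; 3]; [:: 1; 2; 3]]%N ++ bone.

Lemma bone_tetrahedron_rank : rank_at_most K (faces_of bone_tetrahedron) 9.
Proof.
apply: (@field_rank _ _ 9 1 shear_poly (fun X _ => shear X 4)) => //.
- exact: shear_poly_neq0.
- move=> x /shear_free /(@free_family_comb _ _ _ (fun k => (k == 2 :> nat)%:R) (inord 2)).
  rewrite inordK // eqxx oner_neq0 => /(_ isT) free c c0; apply: free => e.
  rewrite -[RHS](c0 e); apply: eq_bigr => k _; congr (_ * _).
  by rewrite !big_ord_recl big_ord0 /= !mul0r mul1r !add0r addr0.
move=> X k l; rewrite mem_cat => /orP[|lb]; last exact: jet_shear lb.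
by rewrite !inE => lA; repeat (case/orP: lA => [/eqP->|lA]; first by cm_ring); move/eqP: lA => ->; cm_ring.
Qed.

Definition bone_opposite : seq (seq nat) :=
  [:: [:: 2; 3]; [:: 2; 4]; [:: 3; 4]; [:: 2; 3; 4]]%N ++ bone.

Definition slide X i j : K := shear X 2 i j + shear X 3 i j + shear X 4 i j.

Lemma derivation_shear x (k : 'I_3) l : l \in bone ->
  derivation x (field (shear (dist x) k.+2)) (cm_poly K 4 l l) = 0.
Proof.
move=> lb; have rl : inrange 4 l by move: l lb; apply/allP.
by rewrite derivation_jet // jet_shear //; case: k => -[|[|[|]]].
Qed.

(** A single direction lowers the rank from 10 to 9, and it may be chosen anew at each point, as
    [bone_far_rank] requires. *)
Lemma rank_at_most_comb L (g : {mpoly K[#|edge 4|]}) : g != 0 ->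
  (forall x, poly_eval (g * shear_poly) x != 0 ->
    exists (c : 'I_3 -> K) k, c k != 0 /\ {in faces_of L, forall S, derivation x
      (fun e => \sum_(l < 3) c l * field (shear (dist x) l.+2) e) (heron_poly K S) = 0}) ->
  rank_at_most K (faces_of L) 9.
Proof.
move=> nz_g orth; exists (g * shear_poly); first by rewrite mulf_neq0 ?shear_poly_neq0.
move=> x B nz sBL indep; have [c [k [nz_ck ck0]]] := orth x nz.
have [_ nz_s] : poly_eval g x != 0 /\ poly_eval shear_poly x != 0.
  by apply/andP; rewrite -negb_or -mulf_eq0 -[X in ~~ (X == 0)]mevalM.
rewrite -(leq_add2r 1%N) -[(9 + 1)%N]/10%N -card_edge4.
apply: (indep_at_card indep (free_family_comb (shear_free nz_s) nz_ck)) => _ S SB.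
exact/ck0/(fintype.subsetP sBL).
Qed.

(* Sliding the three points 2, 3 and 4 together preserves their mutual
   distances. *)
Lemma bone_opposite_rank : rank_at_most K (faces_of bone_opposite) 9.
Proof.
apply: (@rank_at_most_comb _ 1) => [|x _]; first exact: oner_neq0.
exists (fun=> 1), ord0; split=> [|S]; first exact: oner_neq0.
rewrite inE mem_cat => /orP[So|Sb]; last first.
  rewrite derivation_heron derivation_comb big1 ?mulr0 // => k _.
  by rewrite derivation_shear ?mulr0.
have -> : (fun e => \sum_(l < 3) 1 * field (shear (dist x) l.+2) e) =
    field (slide (dist x)) :> (edge 4 -> K).
  by apply/funext => e; rewrite !big_ord_recl big_ord0 !mul1r addr0 addrA.
have {So} sub i : i \in points (val S) -> i \in [:: 2; 3; 4]%N.
  by move: So; rewrite !inE => /or4P[] /eqP ->; rewrite !inE => iS; rewrite -?orbA ?iS ?orbT //; case/orP: iS => ->; rewrite ?orbT.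
apply: derivation_heron_eq0 => i j iS jS.
rewrite dist_field ?(points_lt iS) ?(points_lt jS) //.
have := sub i iS; have := sub j jS; rewrite !inE.
by case/or3P=> /eqP->; case/or3P=> /eqP->; rewrite /slide; cm_ring.
Qed.

Definition bone_far : seq (seq nat) :=
  [:: [:: 2; 3; 4]; [:: 0; 2; 3; 4]; [:: 1; 2; 3; 4]]%N ++ bone.

Lemma cm_polyE l l' : size l = size l' ->
  cm_poly K 4 l l' = cm_minor (ring_ops {mpoly K[#|edge 4|]}) (sym_ext (var_dist K 4)) l l'.
Proof. by move=> esz; apply: eq_cm_minor => // i j _ _; apply: var_dist_sym_ext. Qed.

Lemma derivationB x v p q : derivation x v (p - q) = derivation x v p - derivation x v q.
Proof.
rewrite /derivation -sumrB; apply: eq_bigr => e _.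
by rewrite mderivB [poly_eval _ _]mevalB mulrBr.
Qed.

Lemma derivationD x v p q : derivation x v (p + q) = derivation x v p + derivation x v q.
Proof.
rewrite /derivation -big_split; apply: eq_bigr => e _.
by rewrite mderivD [poly_eval _ _]mevalD mulrDr.
Qed.

Lemma regular_neq0 (p : {mpoly K[#|edge 4|]}) :
  poly_eval p (field (fun _ _ => 1)) != 0 -> p != 0.
Proof. by apply: contraNneq => ->; rewrite [poly_eval _ _]meval0. Qed.

(** By bilinearity this is the derivative of the bordered determinant with 0 replaced by the
    difference of 0 and 1: up to a constant, the Gram determinant of p_3 - p_2, p_4 - p_2 and p_1 -
    p_0. Shears add multiples of the last vector to the other two. *)
Lemma jet_shear_sum X a : a \in [:: 2; 3; 4]%N ->
  (jet X (shear X a) [:: 0; 2; 3; 4]%N [:: 0; 2; 3; 4]%N).2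
  + (jet X (shear X a) [:: 1; 2; 3; 4]%N [:: 1; 2; 3; 4]%N).2
  - 2%:R * (jet X (shear X a) [:: 0; 2; 3; 4]%N [:: 1; 2; 3; 4]%N).2 = 0.
Proof. by rewrite !inE => /or3P[] /eqP->; cm_ring. Qed.

Lemma derivation_shear_sum x (k : 'I_3) (D := derivation x (field (shear (dist x) k.+2))) :
  D (cm_poly K 4 [:: 0; 2; 3; 4]%N [:: 0; 2; 3; 4]%N)
  + D (cm_poly K 4 [:: 1; 2; 3; 4]%N [:: 1; 2; 3; 4]%N)
  - 2%:R * D (cm_poly K 4 [:: 0; 2; 3; 4]%N [:: 1; 2; 3; 4]%N) = 0.
Proof.
rewrite -[RHS](@jet_shear_sum (dist x) k.+2); last by case: k @D => -[|[|[|]]].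
by congr (_ + _ - _ * _); apply: derivation_jet.
Qed.

End SpecialFlats.

Section DodgsonFlats.
Variable K : numFieldType.
Implicit Types (x v : edge 4 -> K) (X : nat -> nat -> K).

(** With [F], [P0] and [P1] stationary the last hypothesis makes [W] stationary, and the
    differentiated identity reduces to [F] times the derivative of [T]. *)
Lemma derivation_dodgson x v (F T P0 P1 W : {mpoly K[#|edge 4|]})
    (D := derivation x v) :
  F * T = P0 * P1 - W ^+ 2 -> poly_eval F x != 0 -> D F = 0 -> D P0 = 0 ->
  D P1 = 0 -> D (P0 + P1 - 2%:R *: W) = 0 -> D T = 0.
Proof.
rewrite /D derivationB derivationD derivationZ => FT nz_F DF D0 D1.
rewrite D0 D1 !add0r => /eqP; rewrite oppr_eq0 mulf_eq0 pnatr_eq0 => /eqP DW.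
have := congr1 (derivation x v) FT; rewrite derivationB expr2 !derivationM.
rewrite DF D0 D1 DW !(mul0r, mulr0, add0r, oppr0) => /eqP.
by rewrite mulf_eq0 (negPf nz_F) => /eqP.
Qed.

(* Some shear combination preserves the volumes of 0234 and 1234; by
   [jet_shear_sum] and [dodgson01] it then also preserves the area of 234. *)
Lemma bone_far_rank : rank_at_most K (faces_of bone_far) 9.
Proof.
pose F := cm_poly K 4 [:: 0; 1; 2; 3; 4]%N [:: 0; 1; 2; 3; 4]%N.
pose P0 := cm_poly K 4 [:: 0; 2; 3; 4]%N [:: 0; 2; 3; 4]%N.
pose P1 := cm_poly K 4 [:: 1; 2; 3; 4]%N [:: 1; 2; 3; 4]%N.
pose W := cm_poly K 4 [:: 0; 2; 3; 4]%N [:: 1; 2; 3; 4]%N.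
pose T := cm_poly K 4 [:: 2; 3; 4]%N [:: 2; 3; 4]%N.
have FT : F * T = P0 * P1 - W ^+ 2 by rewrite /F /T /P0 /P1 /W !cm_polyE // dodgson01.
apply: (@rank_at_most_comb K _ F) => [|x nz].
  apply: regular_neq0; rewrite poly_eval_regular //.
  have -> : cm_minor (ring_ops K) (sym_ext (fun _ _ => 1)) [:: 0; 1; 2; 3; 4]%N
      [:: 0; 1; 2; 3; 4]%N = - 5%:R by cm_ring.
  by rewrite oppr_eq0 pnatr_eq0.
have nz_F : poly_eval F x != 0.
  by apply: contraNneq nz => F0; rewrite [poly_eval _ _]mevalM [meval _ F]F0 mul0r.
pose w (k : 'I_3) : edge 4 -> K := field (shear (dist x) k.+2).
(* Two conditions on three shears leave a nonzero solution. *)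
pose N : 'M[K]_(3, 2) :=
  \matrix_(k, j) derivation x (w k) (if j == ord0 then P0 else P1).
have [c nz_c cN0] : exists2 c : 'rV_3, c != 0 & c *m N = 0.
  have : kermx N != 0.
    by rewrite kermx_eq0 -row_leq_rank -ltnNge (leq_ltn_trans (rank_leq_col N)).
  by case/rowV0Pn => c; rewrite sub_kermx => /eqP cN0 nz_c; exists c.
have /rV0Pn[k nz_ck] := nz_c; exists (c 0), k; split=> // S.
pose D := derivation x (fun e => \sum_(l < 3) c 0 l * w l e).
have DE p : D p = \sum_(l < 3) c 0 l * derivation x (w l) p by apply: derivation_comb.
have D0 : D P0 = 0.
  have /rowP/(_ ord0) := cN0; rewrite !mxE DE => cN0j; rewrite -[RHS]cN0j.
  by apply: eq_bigr => l _; rewrite !mxE.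
have D1 : D P1 = 0.
  have /rowP/(_ (lift ord0 ord0)) := cN0; rewrite !mxE DE => cN0j; rewrite -[RHS]cN0j.
  by apply: eq_bigr => l _; rewrite !mxE.
have Dbone l : l \in bone -> D (cm_poly K 4 l l) = 0.
  by move=> lb; rewrite DE big1 // => i _; rewrite derivation_shear ?mulr0.
have DW : D (P0 + P1 - 2%:R *: W) = 0.
  rewrite DE big1 // => l _; rewrite derivationB derivationD derivationZ.
  by rewrite derivation_shear_sum mulr0.
have DT := derivation_dodgson FT nz_F (Dbone [:: 0; 1; 2; 3; 4]%N isT) D0 D1 DW.
rewrite inE derivation_heron => SL.
suff DS : D (cm_poly K 4 (points (val S)) (points (val S))) = 0.
  by move: DS; rewrite /D => ->; rewrite mulr0.
move: SL; rewrite mem_cat => /orP[|/Dbone//]; rewrite !inE.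
by case/or3P=> /eqP ->; [exact: DT | exact: D0 | exact: D1].
Qed.

(** Each differentiated Desnanot-Jacobi identity contains 2 W_i D W_i. Multiplying by the other
    three W_j and summing with alternating signs leaves the alternating sum of the D W_i, which is -
    D V. The terms are ordered as in [pyramid]. *)
Lemma derivation_apex x v (F V A0 A1 A2 A3 U0 U1 U2 U3 W0 W1 W2 W3 : {mpoly K[#|edge 4|]})
    (D := derivation x v) (e := fun p : {mpoly K[#|edge 4|]} => poly_eval p x) :
  F * A0 = U0 * V - W0 ^+ 2 -> F * A1 = U1 * V - W1 ^+ 2 ->
  F * A2 = U2 * V - W2 ^+ 2 -> F * A3 = U3 * V - W3 ^+ 2 ->
  W0 - W1 + W2 - W3 + V = 0 ->
  e W0 * e W1 * e W2 * e F * D A3 + (- (e W0 * e W1 * e W3 * e F) * D A2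
  + (e W0 * e W2 * e W3 * e F * D A1 + (- (e W1 * e W2 * e W3 * e F) * D A0
  + ((e W1 * e W2 * e W3 * e U0 - e W0 * e W2 * e W3 * e U1 + e W0 * e W1 * e W3 * e U2
      - e W0 * e W1 * e W2 * e U3 + 2%:R * e W0 * e W1 * e W2 * e W3) * D V
  + (- (e W0 * e W1 * e W2 * e V) * D U3 + (e W0 * e W1 * e W3 * e V * D U2
  + (- (e W0 * e W2 * e W3 * e V) * D U1 + (e W1 * e W2 * e W3 * e V * D U0
  + - (e W1 * e W2 * e W3 * e A0 - e W0 * e W2 * e W3 * e A1 + e W0 * e W1 * e W3 * e A2
      - e W0 * e W1 * e W2 * e A3) * D F)))))))) = 0.
Proof.
have dodgson A U W : F * A = U * V - W ^+ 2 ->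
    e V * D U + e U * D V - e F * D A - e A * D F = 2%:R * e W * D W.
  move=> /(congr1 D); rewrite /D derivationB expr2 !derivationM /e => E.
  have {E} /eqP := E; rewrite -subr_eq0 => /eqP E.
  apply/eqP; rewrite -subr_eq0 -[X in _ == X]oppr0 -[X in _ == - X]E; apply/eqP; ring.
move=> /dodgson E0 /dodgson E1 /dodgson E2 /dodgson E3 /(congr1 D).
have -> : D 0 = 0 by rewrite /D -[X in derivation x v X](subrr F) derivationB subrr.
have -> : D (W0 - W1 + W2 - W3 + V) = D W0 - D W1 + D W2 - D W3 + D V.
  by rewrite /D derivationD derivationB derivationD derivationB.
clearbody D e => /eqP; rewrite addrC addr_eq0 => /eqP DV.
transitivity (e W1 * e W2 * e W3 * (2%:R * e W0 * D W0)
  - e W0 * e W2 * e W3 * (2%:R * e W1 * D W1)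
  + e W0 * e W1 * e W3 * (2%:R * e W2 * D W2)
  - e W0 * e W1 * e W2 * (2%:R * e W3 * D W3)
  + 2%:R * e W0 * e W1 * e W2 * e W3 * D V); last by rewrite DV; ring.
by rewrite -E0 -E1 -E2 -E3; ring.
Qed.

Definition pyramid : seq (seq nat) :=
  [:: [:: 0; 1; 2]; [:: 0; 1; 3]; [:: 0; 2; 3]; [:: 1; 2; 3]; [:: 0; 1; 2; 3];
      [:: 0; 1; 2; 4]; [:: 0; 1; 3; 4]; [:: 0; 2; 3; 4]; [:: 1; 2; 3; 4];
      [:: 0; 1; 2; 3; 4]]%N.

Lemma sum_pyramid (f : seq nat -> K) : \sum_(l <- pyramid) f l =
  f [:: 0; 1; 2]%N + (f [:: 0; 1; 3]%N + (f [:: 0; 2; 3]%N + (f [:: 1; 2; 3]%N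
  + (f [:: 0; 1; 2; 3]%N + (f [:: 0; 1; 2; 4]%N + (f [:: 0; 1; 3; 4]%N
  + (f [:: 0; 2; 3; 4]%N + (f [:: 1; 2; 3; 4]%N + f [:: 0; 1; 2; 3; 4]%N)))))))).
Proof. by rewrite !big_cons big_nil addr0. Qed.

Definition valid_face (l : seq nat) := (l == [seq i <- iota 0 5 | i \in l]) && (2 <= size l)%N.

Lemma points_faces_of L : uniq L -> all valid_face L ->
  perm_eq [seq points (val T) | T <- enum (faces_of L)] L.
Proof.
move=> uL /allP vL; apply: uniq_perm => // [|l].
  by rewrite map_inj_uniq ?enum_uniq // => S T /points_inj/val_inj.
apply/mapP/idP => [[S]|lL]; first by rewrite mem_enum inE => SL ->.
have /andP[/eqP el szl] := vL l lL; have [S eS] := face_ex el szl.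
by exists S; rewrite // mem_enum inE eS.
Qed.

Lemma sum_faces_of L (f : seq nat -> K) : uniq L -> all valid_face L ->
  \sum_(S in faces_of L) f (points (val S)) = \sum_(l <- L) f l.
Proof.
move=> uL vL; rewrite -big_enum -(big_map (fun S : face 4 => points (val S)) predT f).
exact/perm_big/points_faces_of.
Qed.

Lemma card_faces_of L : (#|faces_of L| <= size L)%N.
Proof.
rewrite cardE -(size_map (fun S : face 4 => points (val S))).
apply: uniq_leq_size => [|l /mapP[S]].
  by rewrite map_inj_uniq ?enum_uniq // => S T /points_inj/val_inj.
by rewrite mem_enum inE => SL ->.
Qed.

Lemma regular_minor t :
  t \in [:: [:: 1; 2; 3]; [:: 0; 2; 3]; [:: 0; 1; 3]; [:: 0; 1; 2]]%N ->
  cm_minor (ring_ops K) (sym_ext (fun _ _ => 1)) [:: 0; 1; 2; 3]%N (rcons t 4%N) ^+ 2 = 1.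
Proof. by rewrite !inE => /or4P[] /eqP->; cm_ring. Qed.

(* Over the base 0123, the foot of the apex 4 has barycentric coordinates
   proportional to the minors W_i, which sum to the base minor V. *)
Lemma pyramid_rank : rank_at_most K (faces_of pyramid) 9.
Proof.
pose P l := cm_poly K 4 l l.
pose W l := cm_poly K 4 [:: 0; 1; 2; 3]%N (rcons l 4%N).
pose V := P [:: 0; 1; 2; 3]%N; pose F := P [:: 0; 1; 2; 3; 4]%N.
have dodgson l : l \in [:: [:: 1; 2; 3]; [:: 0; 2; 3]; [:: 0; 1; 3]; [:: 0; 1; 2]]%N ->
    F * P l = P (rcons l 4%N) * V - W l ^+ 2.
  move=> lL; have szl : 4%N = size (rcons l 4%N).
    by move: lL; rewrite !inE => /or4P[] /eqP->.
  rewrite /W (@cm_polyE K [:: 0; 1; 2; 3]%N _ szl) /F /V /P.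
  rewrite (@cm_polyE K [:: 0; 1; 2; 3; 4]%N _ erefl) (@cm_polyE K l l erefl) (@cm_polyE K (rcons l 4%N) _ erefl).
  by rewrite (@cm_polyE K [:: 0; 1; 2; 3]%N _ erefl); apply: dodgson4.
have cofW : W [:: 1; 2; 3]%N - W [:: 0; 2; 3]%N + W [:: 0; 1; 3]%N - W [:: 0; 1; 2]%N + V = 0.
  rewrite /W /V /P.
  rewrite (@cm_polyE K [:: 0; 1; 2; 3]%N (rcons [:: 1; 2; 3]%N 4%N) erefl) (@cm_polyE K [:: 0; 1; 2; 3]%N (rcons [:: 0; 2; 3]%N 4%N) erefl).
  rewrite (@cm_polyE K [:: 0; 1; 2; 3]%N (rcons [:: 0; 1; 3]%N 4%N) erefl) (@cm_polyE K [:: 0; 1; 2; 3]%N (rcons [:: 0; 1; 2]%N 4%N) erefl).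
  by rewrite (@cm_polyE K [:: 0; 1; 2; 3]%N [:: 0; 1; 2; 3]%N erefl); apply: cofactor_sum4.
(* The coefficient of the face 1234 in the relation of [derivation_apex]; where it is nonzero the
   relation is nontrivial. *)
pose g := W [:: 0; 2; 3]%N * W [:: 0; 1; 3]%N * W [:: 0; 1; 2]%N * V.
have nzW l : l \in [:: [:: 1; 2; 3]; [:: 0; 2; 3]; [:: 0; 1; 3]; [:: 0; 1; 2]]%N -> W l != 0.
  move=> lL; apply: regular_neq0; rewrite /W poly_eval_regular //; last first.
  - by move: lL; rewrite !inE => /or4P[] /eqP->.
  - by move: lL; rewrite !inE => /or4P[] /eqP->.
  by rewrite -sqrf_eq0 regular_minor ?oner_neq0.
have nzV : V != 0.
  apply: regular_neq0; rewrite poly_eval_regular //.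
  have -> : cm_minor (ring_ops K) (sym_ext (fun _ _ => 1)) [:: 0; 1; 2; 3]%N
      [:: 0; 1; 2; 3]%N = 4%:R by cm_ring.
  by rewrite pnatr_eq0.
clearbody W; exists g => [|x B nz sBL indep].
  exact: (mulf_neq0 (mulf_neq0 (mulf_neq0 (nzW [:: 0; 2; 3]%N isT)
    (nzW [:: 0; 1; 3]%N isT)) (nzW [:: 0; 1; 2]%N isT)) nzV).
rewrite leqNgt; apply/negP => ltB.
(* More than nine of the ten faces means all of them, so one relation among all ten suffices. *)
have eB : B = faces_of pyramid.
  by apply/eqP; rewrite eqEcard sBL (leq_trans (card_faces_of _)).
pose e p := poly_eval p x.
pose w0 := e (W [:: 1; 2; 3]%N); pose w1 := e (W [:: 0; 2; 3]%N).
pose w2 := e (W [:: 0; 1; 3]%N); pose w3 := e (W [:: 0; 1; 2]%N).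
pose cs : seq K := [:: w0 * w1 * w2 * e F; - (w0 * w1 * w3 * e F); w0 * w2 * w3 * e F;
  - (w1 * w2 * w3 * e F);
  w1 * w2 * w3 * e (P [:: 1; 2; 3; 4]%N) - w0 * w2 * w3 * e (P [:: 0; 2; 3; 4]%N)
  + w0 * w1 * w3 * e (P [:: 0; 1; 3; 4]%N) - w0 * w1 * w2 * e (P [:: 0; 1; 2; 4]%N)
  + 2%:R * w0 * w1 * w2 * w3;
  - (w0 * w1 * w2 * e V); w0 * w1 * w3 * e V; - (w0 * w2 * w3 * e V); w1 * w2 * w3 * e V;
  - (w1 * w2 * w3 * e (P [:: 1; 2; 3]%N) - w0 * w2 * w3 * e (P [:: 0; 2; 3]%N)
  + w0 * w1 * w3 * e (P [:: 0; 1; 3]%N) - w0 * w1 * w2 * e (P [:: 0; 1; 2]%N))].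
pose f l := nth 0 cs (index l pyramid).
pose c (S : face 4) := f (points (val S)) / cm_scale K #|val S|.
have sum0 v : \sum_(S in B) c S * derivation x v (heron_poly K S) = 0.
  transitivity (\sum_(S in faces_of pyramid)
      (fun l => f l * derivation x v (P l)) (points (val S))).
    rewrite eB; apply: eq_bigr => S _; rewrite derivation_heron mulrA /c.
    by rewrite mulfVK ?cm_scale_neq0.
  rewrite (@sum_faces_of pyramid (fun l => f l * derivation x v (P l))) //.
  rewrite sum_pyramid.
  exact: (derivation_apex x v (dodgson [:: 1; 2; 3]%N isT) (dodgson [:: 0; 2; 3]%N isT)
    (dodgson [:: 0; 1; 3]%N isT) (dodgson [:: 0; 1; 2]%N isT) cofW).
have [S eS] : exists S : face 4, points (val S) = [:: 1; 2; 3; 4]%N by apply: face_ex.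
have /indep_atP/(_ c sum0 S) := indep.
rewrite eB inE eS => /(_ isT)/eqP; rewrite /c eS mulf_eq0 invr_eq0 (negPf (cm_scale_neq0 _ _)) orbF.
by apply/negP; rewrite /poly_eval /g !mevalM in nz.
Qed.

End DodgsonFlats.

(** * Elimination modulo 3 *)

(* The field with three elements: None is 0 and Some b is 1 or -1. *)
Definition trit := option bool.

Definition trit_opp (a : trit) : trit :=
  if a is Some s then Some (if s then false else true) else None.

Definition trit_add (a b : trit) : trit :=
  match a, b with
  | None, _ => b
  | _, None => a
  | Some s, Some t => if s then (if t then Some false else None)
                      else (if t then None else Some true)
  end.

Definition trit_mul (a b : trit) : trit :=
  match a, b with
  | Some s, Some t => Some (if s then t else if t then false else true)
  | _, _ => None
  end.

Definition trit_ops : ops trit := Ops None (Some true) trit_opp trit_add trit_mul.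

Definition int_of_trit (a : trit) : int :=
  if a is Some s then (if s then 1 else - 1) else 0.

Definition tval (a : trit) : 'F_3 := (int_of_trit a)%:~R.

Lemma trit_ops_rel :
  ops_rel trit_ops (ring_ops int) (fun a z => tval a = z%:~R).
Proof.
have tN a : tval (trit_opp a) = - tval a by case: a => [[]|]; apply/eqP.
have tD a b : tval (trit_add a b) = tval a + tval b.
  by case: a b => [[]|] [[]|]; apply/eqP.
have tM a b : tval (trit_mul a b) = tval a * tval b.
  by case: a b => [[]|] [[]|]; apply/eqP.
split=> //= [a z az|a z b y az bya|a z b y az bya].
- by rewrite tN az rmorphN.
- by rewrite tD az bya rmorphD.
- by rewrite tM az bya rmorphM.
Qed.

Section Elimination.
Implicit Types (r w : seq trit) (rs : seq (seq trit)).

Fixpoint vadd (u v : seq trit) : seq trit :=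
  match u, v with a :: u', b :: v' => trit_add a b :: vadd u' v' | _, _ => [::] end.

Definition rotl w := if w is h :: t then rcons t h else [::].

Definition rowop (plus minus w : seq trit) : seq trit :=
  match w with
  | [::] => [::]
  | None :: t => t
  | Some s :: t => vadd t (if s then minus else plus)
  end.

(** Leading zeros of [r] are rotated to the end in all rows, a mere permutation of columns, so the
    pivot is always in front and its column is dropped. With [m] the number of columns, [None] means
    that [r] is zero. *)
Fixpoint eliminate (m : nat) r rs : option (seq (seq trit)) :=
  match m, r with
  | m'.+1, Some s :: t => let t' := map trit_opp t in
      Some (if s then map (rowop t t') rs else map (rowop t' t) rs)
  | m'.+1, None :: t => eliminate m' (rcons t None) (map rotl rs)
  | _, _ => None
  end.

(** Rows beyond the selector are returned in reduced form, so the work on a prefix of a code is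
    shared by all its extensions; see [reduce_cat]. *)
Fixpoint reduce (sel : seq bool) (m : nat) rs : option (seq (seq trit)) :=
  match sel, rs with
  | b :: sel', r :: rs' =>
      if b then if eliminate m r rs' is Some q then reduce sel' m.-1 q else None
      else reduce sel' m rs'
  | _, _ => Some rs
  end.

Lemma reduce_cat s1 s2 m rs : (size s1 <= size rs)%N ->
  reduce (s1 ++ s2) m rs =
  if reduce s1 m rs is Some q then reduce s2 (m - count id s1) q else None.
Proof.
have szel k r rs' q : eliminate k r rs' = Some q -> size q = size rs'.
  elim: k r rs' => // k IHk [//|[s|] t] rs' /=.
    by case: s => -[<-]; rewrite size_map.
  by move=> /IHk; rewrite size_map.
elim: s1 m rs => [|b s1 IHs] m rs; first by rewrite subn0.
case: rs => [//|r rs]; rewrite ltnS /= => les.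
case: b => /=; last by rewrite add0n IHs.
case el : eliminate => [q|//]; rewrite IHs ?(szel _ _ _ _ el) //.
by case: reduce => // q'; congr (reduce _ _ _); lia.
Qed.

Let ent w j : 'F_3 := tval (nth None w j).
Let comb (c : nat -> 'F_3) rs j := \sum_(i < size rs) c i * ent (nth [::] rs i) j.

Let ent_vadd u v j : size u = size v -> ent (vadd u v) j = ent u j + ent v j.
Proof.
rewrite /ent; elim: u v j => [|a u IHu] [|b v] // j.
  by rewrite nth_nil addr0.
move=> [esz]; case: j => [|j] /=; last exact: IHu.
by case: a b {esz} => [[]|] [[]|]; apply/eqP.
Qed.

Let size_vadd u v : size u = size v -> size (vadd u v) = size u.
Proof. by elim: u v => [|a u IHu] [|b v] //= /eqP; rewrite eqSS => /eqP/IHu->. Qed.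

Let ent_opp t j : ent (map trit_opp t) j = - ent t j.
Proof.
rewrite /ent; elim: t j => [|a t IHt] [|j] //=; try exact/eqP.
by case: a => [[]|]; apply/eqP.
Qed.

Let comb_map f c rs j : comb c (map f rs) j = \sum_(i < size rs) c i * ent (f (nth [::] rs i)) j.
Proof.
by rewrite /comb size_map; apply: eq_bigr => i _; rewrite (nth_map [::]).
Qed.

(** Row operations only subtract multiples of the pivot row, so the other coefficients of a relation
    survive unchanged; the pivot column then determines [c0]. *)
Lemma eliminate_sound k m r rs q (c0 : 'F_3) (c : nat -> 'F_3) :
  eliminate k r rs = Some q -> size r = m.+1 -> all (fun w => size w == m.+1) rs ->
  (forall j, c0 * ent r j + comb c rs j = 0) ->
  [/\ size q = size rs, all (fun w => size w == m) q, forall j, comb c q j = 0 &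
      (forall i, (i < size rs)%N -> c i = 0) -> c0 = 0].
Proof.
elim: k r rs => // k IHk [//|a t] rs /=.
case: a => [s|] el [szt] /allP szrs rel0; last first.
  have rot w j : size w = m.+1 -> ent (rotl w) j =
      if (j < m)%N then ent w j.+1 else if j == m then ent w 0 else 0.
    rewrite /ent; case: w => //= h u [szu]; rewrite nth_rcons szu.
    by case: ltngtP.
  have [||j|q1 q2 q3 q4] := IHk _ _ el.
  - by rewrite size_rcons szt.
  - by apply/allP => _ /mapP[w /szrs/eqP szw ->]; case: w szw => //= h u; rewrite size_rcons => ->.
  - rewrite comb_map -[rcons t None]/(rotl (None :: t)) rot /= ?szt //.
    rewrite (eq_bigr (fun i : 'I__ => c i * (if (j < m)%N then ent (nth [::] rs i) j.+1
      else if j == m then ent (nth [::] rs i) 0 else 0))); last first.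
      by move=> i _; rewrite rot //; apply/eqP/szrs/mem_nth.
    case: ifP => _; first exact: rel0.
    case: ifP => _; first exact: rel0.
    by rewrite mulr0 add0r big1 // => i _; rewrite mulr0.
  by split=> // [|c1]; [rewrite q1 size_map | apply: q4; rewrite size_map].
pose sg := tval (Some s); have sg2 : sg * sg = 1 by case: (s) @sg; apply/eqP.
have {el} eq : q = map (rowop (if s then t else map trit_opp t)
    (if s then map trit_opp t else t)) rs by case: (s) el => -[<-].
have entq w j : size w = m.+1 ->
    ent (rowop (if s then t else map trit_opp t) (if s then map trit_opp t else t) w) j =
    ent w j.+1 - ent w 0 * sg * ent t j.
  case: w => //= h u [szu]; rewrite /sg; case: h => [h|] /=; last first.
    by rewrite [ent _ 0]/(0 : 'F_3) !mul0r subr0.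
  rewrite ent_vadd; last by case: h; case: (s); rewrite ?size_map szu szt.
  by congr (_ + _); case: h; case: (s); rewrite ?ent_opp /ent /tval /= ?mul1r ?mulN1r ?mulr1 ?mulrN1 ?opprK ?mulNr ?mul1r.
have e0 : ent (Some s :: t) 0 = sg by [].
have eS j : ent (Some s :: t) j.+1 = ent t j by [].
split.
- by rewrite eq size_map.
- apply/allP => x; rewrite eq => /mapP[w /szrs/eqP szw ->{x}].
  case: w szw => //= h u [szu]; case: h => [h|]; last by rewrite szu.
  by rewrite size_vadd szu //; case: h; case: (s); rewrite ?size_map szt.
- move=> j; rewrite eq comb_map.
  rewrite (eq_bigr (fun i : 'I__ => c i * ent (nth [::] rs i) j.+1
     - (c i * ent (nth [::] rs i) 0) * (sg * ent t j))); last first.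
    by move=> i _; rewrite entq ?(eqP (szrs _ (mem_nth _ _))) //; ring.
  rewrite sumrB -mulr_suml; have := rel0 0%N; have := rel0 j.+1; rewrite /comb.
  rewrite eS e0 => /eqP.
  rewrite addrC addr_eq0 => /eqP-> /eqP; rewrite addrC addr_eq0 => /eqP->.
  by rewrite mulNr opprK -mulrA [sg * (_ * _)]mulrA sg2 mul1r addNr.
move=> c1; have := rel0 0%N; rewrite /comb big1 => [|i _]; last by rewrite c1 ?mul0r.
rewrite addr0 e0 => /(congr1 (fun z => z * sg)).
by rewrite mul0r -mulrA sg2 mulr1.
Qed.

Lemma reduce_sound sel m rs q (c : nat -> 'F_3) :
  reduce sel m rs = Some q -> all (fun w => size w == m) rs ->
  (forall i, ~~ nth false sel i -> c i = 0) -> (forall j, comb c rs j = 0) ->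
  forall i, (i < size rs)%N -> c i = 0.
Proof.
elim: sel m rs c => [|b sel IHsel] m [|r rs] c //=; first by move=> _ _ c0 _ i _; rewrite c0 ?nth_nil.
have combS j : comb c (r :: rs) j = c 0%N * ent r j + comb (c \o succn) rs j.
  by rewrite /comb big_ord_recl.
case: b => red /andP[/eqP szr szrs] c0 rel0; last first.
  have c00 : c 0%N = 0 by apply: (c0 0%N).
  have IH := IHsel _ _ (c \o succn) red szrs (fun i => c0 i.+1).
  case=> [|i] //; apply: IH => j.
  by rewrite -[RHS](rel0 j) combS c00 mul0r add0r.
case el : eliminate red => [q'|//] red.
case: m => [|m] in szr szrs el red *; first by case: (r) szr el.
have rel0' j : c 0%N * ent r j + comb (c \o succn) rs j = 0 by rewrite -combS.
have [q1 q2 q3 q4] := eliminate_sound el szr szrs rel0'.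
have IH := IHsel _ _ (c \o succn) red q2 (fun i => c0 i.+1) q3.
have cS i : (i < size rs)%N -> c i.+1 = 0 by rewrite -q1 => /IH.
by case=> [_|i]; [apply: q4 | apply: cS].
Qed.

End Elimination.

(** * Jacobian certificates for independence *)

Definition edges5 : seq (seq nat) :=
  [:: [:: 0; 1]; [:: 0; 2]; [:: 0; 3]; [:: 0; 4]; [:: 1; 2]; [:: 1; 3]; [:: 1; 4];
      [:: 2; 3]; [:: 2; 4]; [:: 3; 4]]%N.

Definition tetrahedra5 : seq (seq nat) :=
  [:: [:: 0; 1; 2; 3]; [:: 0; 1; 2; 4]; [:: 0; 1; 3; 4]; [:: 0; 2; 3; 4];
      [:: 1; 2; 3; 4]]%N.

Definition triangles5 : seq (seq nat) :=
  [:: [:: 0; 1; 2]; [:: 0; 1; 3]; [:: 0; 1; 4]; [:: 0; 2; 3]; [:: 0; 2; 4];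
      [:: 0; 3; 4]; [:: 1; 2; 3]; [:: 1; 2; 4]; [:: 1; 3; 4]; [:: 2; 3; 4]]%N.

(** Edges occupy the positions 0-9, tetrahedra 10-14, the simplex 15 and triangles 16-25; the
    offsets 10, 15 and 16 below refer to this order. *)
Definition faces5 : seq (seq nat) :=
  edges5 ++ tetrahedra5 ++ [:: [:: 0; 1; 2; 3; 4]%N] ++ triangles5.

Section Tables.
Variables (T : Type) (o : ops T).

Definition edge_index i j := index [:: minn i j; maxn i j] edges5.

(* A diagonal entry has index 10, hence gets the default value. *)
Definition table (p : seq T) i j : T := nth (op0 o) p (edge_index i j).

(** Tabulated once per point and direction, so that determinants need not search [edges5]. *)
Definition table_mx p : seq (seq T) :=
  [seq [seq table p i j | j <- iota 0 5] | i <- iota 0 5].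

Definition mx_entry (m : seq (seq T)) i j : T := nth (op0 o) (nth [::] m i) j.

Lemma mx_entryE p i j : (i < 5)%N -> (j < 5)%N -> mx_entry (table_mx p) i j = table p i j.
Proof.
move=> lti ltj; rewrite /mx_entry (nth_map 0%N) ?size_iota //.
by rewrite (nth_map 0%N) ?size_iota // !nth_iota.
Qed.

Definition unit_jet (p : seq T) k : seq (T * T) :=
  [seq (nth (op0 o) p e, if Nat.eqb e k then op1 o else op0 o) | e <- iota 0 10].

End Tables.

Lemma dual_ops_rel T U (o : ops T) (o' : ops U) r : ops_rel o o' r ->
  ops_rel (dual_ops o) (dual_ops o') (fun a b => r a.1 b.1 /\ r a.2 b.2).
Proof.
case=> r0 r1 rN rD rM; split=> //=.
- by move=> a b [ab1 ab2]; split; apply: rN.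
- by move=> a b c d [ab1 ab2] [cd1 cd2]; split; apply: rD.
by move=> a b c d [ab1 ab2] [cd1 cd2]; split; [|apply: rD]; apply: rM.
Qed.

Lemma unit_jet_rel T U (o : ops T) (o' : ops U) r p p' k l :
  ops_rel o o' r -> (forall e, r (nth (op0 o) p e) (nth (op0 o') p' e)) ->
  r (cm (dual_ops o) (table (dual_ops o) (unit_jet o p k)) l).2
    (cm (dual_ops o') (table (dual_ops o') (unit_jet o' p' k)) l).2.
Proof.
move=> ro rp; have [r0 r1 _ _ _] := ro.
have [] // := @cm_minor_rel _ _ _ _ _ (table (dual_ops o) (unit_jet o p k))
  (table (dual_ops o') (unit_jet o' p' k)) l l (dual_ops_rel ro) _.
move=> i j; rewrite /table; move: (edge_index i j) => e.
case: (ltnP e 10) => [lte|gee].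
  by rewrite !(nth_map 0%N) ?size_iota //=; split=> //; case: Nat.eqb.
by rewrite !nth_default ?size_map ?size_iota.
Qed.

(* Entry (l, k) is the derivative of the Cayley-Menger determinant of the face l
   with respect to the k-th edge at the point p, modulo 3. *)
Definition jacobian_rows (p : seq trit) : seq (seq trit) :=
  let ms := [seq table_mx (dual_ops trit_ops) (unit_jet trit_ops p k) | k <- iota 0 10] in
  [seq [seq (cm (dual_ops trit_ops) (mx_entry (dual_ops trit_ops) m) l).2 | m <- ms]
    | l <- faces5].

Section RankCertificate.
Variables (K : numFieldType) (p : seq trit).

(** The bridge between the computation with trits, which is its reduction modulo 3, and the
    derivatives over [K]. *)
Definition int_jacobian l k : int :=
  (cm (dual_ops (ring_ops int)) (table (dual_ops (ring_ops int))
    (unit_jet (ring_ops int) (map int_of_trit p) k)) l).2.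

Definition point_of : edge 4 -> K :=
  field (fun i j => (int_of_trit (nth None p (edge_index i j)))%:~R).

Definition unit_of k : edge 4 -> K := field (fun i j => (edge_index i j == k)%:R).

Lemma edge_indexC i j : edge_index i j = edge_index j i.
Proof. by rewrite /edge_index minnC maxnC. Qed.

Lemma edge_index_diag i : (i < 5)%N -> edge_index i i = 10%N.
Proof. by case: i => [|[|[|[|[|]]]]]. Qed.

Lemma edge_index_lt i j : (i < j)%N -> (j < 5)%N -> (edge_index i j < 10)%N.
Proof. by case: j => [|[|[|[|[|]]]]] //; case: i => [|[|[|[|[|]]]]]. Qed.

Lemma int_jacobianE l k : inrange 4 l -> (k < 10)%N ->
  derivation point_of (unit_of k) (cm_poly K 4 l l) = (int_jacobian l k)%:~R.
Proof.
move=> /allP rl ltk; have [_ ->] := first_jet_cm point_of (unit_of k) l l.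
pose r (z : int) (a : K) := a = z%:~R.
have ro : ops_rel (ring_ops int) (ring_ops K) r.
  by split=> //= [z a ->|z a y b -> ->|z a y b -> ->]; rewrite /r ?rmorphN ?rmorphD ?rmorphM.
have rp e : r (nth 0 (map int_of_trit p) e) (nth 0 [seq (int_of_trit a)%:~R | a <- p] e).
  case: (ltnP e (size p)) => [lte|gee]; last by rewrite !nth_default ?size_map.
  by rewrite !(nth_map None).
have <- : (cm _ _ _).2 = (int_jacobian l k)%:~R := unit_jet_rel k l ro rp.
congr (snd _); apply: eq_cm_minor => // i j /rl lti /rl ltj.
rewrite !dist_field // /sym_ext !ltbE /table.
have jet e : (e < 10)%N -> nth (0, 0) (unit_jet (ring_ops K) [seq (int_of_trit a)%:~R | a <- p] k) e
    = ((int_of_trit (nth None p e))%:~R, (e == k)%:R).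
  move=> lte; rewrite (nth_map 0%N) ?size_iota // nth_iota //= eqbE.
  congr (_, _); last by case: eqP.
  case: (ltnP e (size p)) => [ltp|gep]; last by rewrite !nth_default ?size_map.
  by rewrite (nth_map None).
case: (ltngtP i j) => [ltij|ltji|->].
- by rewrite jet ?edge_index_lt.
- by rewrite (edge_indexC i j) jet ?edge_index_lt.
by rewrite edge_index_diag // nth_default ?size_map ?size_iota.
Qed.

Lemma jacobian_rows_entry n k : (n < 26)%N -> (k < 10)%N ->
  tval (nth None (nth [::] (jacobian_rows p) n) k) =
  (int_jacobian (nth [::] faces5 n) k)%:~R.
Proof.
move=> ltn ltk; rewrite /jacobian_rows (nth_map [::]) // (nth_map [::]) ?size_map ?size_iota //.
rewrite (nth_map 0%N) ?size_iota // nth_iota // add0n.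
set l := nth [::] faces5 n.
have rl : {in l, forall i, i < 5}%N.
  have /allP rf : all (inrange 4) faces5 by [].
  by apply/allP/rf/mem_nth.
pose jet := unit_jet trit_ops p k.
have -> : (cm (dual_ops trit_ops) (mx_entry (dual_ops trit_ops)
    (table_mx (dual_ops trit_ops) jet)) l) = cm (dual_ops trit_ops) (table (dual_ops trit_ops) jet) l.
  by apply: eq_cm_minor => // i j /rl lti /rl ltj; apply: mx_entryE.
apply: (unit_jet_rel k l trit_ops_rel) => e.
case: (ltnP e (size p)) => [lte|gee]; last by rewrite !nth_default ?size_map.
by rewrite (nth_map None).
Qed.

Lemma sum_mask (A : nmodType) (f : seq nat -> A) c (s : seq (seq nat)) : uniq s ->
  \sum_(l <- s) (if l \in mask c s then f l else 0) = \sum_(l <- mask c s) f l.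
Proof.
move=> us; rewrite -big_mkcond -big_filter; apply: congr_big => //.
by apply/esym/(subseq_uniqP us)/mask_subseq.
Qed.

Lemma rank_certificate c q : size c = 26%N -> count id c = 10%N ->
  reduce c 10 (jacobian_rows p) = Some q ->
  indep_gradients (@heron_poly K 4) (faces_of (mask c faces5)) point_of.
Proof.
move=> szc cc red; set L := mask c faces5.
have uF : uniq faces5 by [].
have uL : uniq L := mask_uniq uF c.
have szL : size L = 10%N by rewrite size_mask.
pose M : 'M[int]_10 := \matrix_(i, k) int_jacobian (nth [::] L i) k.
have nz_detM : \det M != 0.
  apply/eqP => detM0.
  have : \det (map_mx (intmul (1 : 'F_3)) M) == 0 by rewrite det_map_mx detM0 rmorph0.
  case/det0P => v nz_v vM0; case/rV0Pn: nz_v => i; case/negP; apply/eqP.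
  pose g l : 'F_3 := v 0 (inord (index l L)).
  (* The kernel vector on the ten chosen rows is extended by zero to all 26, the form required by
     [reduce_sound]. *)
  pose cf n := if nth [::] faces5 n \in L then g (nth [::] faces5 n) else 0.
  have sumL (h : seq nat -> 'F_3) : \sum_(l <- L) h l = \sum_(n < 10) h (nth [::] L n).
    by rewrite (big_nth [::]) szL big_mkord.
  have gL (n : 'I_10) : g (nth [::] L n) = v 0 n.
    by rewrite /g index_uniq ?szL ?inord_val.
  have szR : size (jacobian_rows p) = 26%N by rewrite size_map.
  have rows10 : all (fun w => size w == 10%N) (jacobian_rows p).
    by apply/allP => _ /mapP[l _ ->]; rewrite !size_map size_iota.
  have cf_sel n : ~~ nth false c n -> cf n = 0.
    move=> ncn; rewrite /cf; case: ifP => // nL.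
    move: nL; rewrite in_mask // => /andP[nF].
    have ltn : (n < 26)%N.
      by rewrite ltnNge; apply/negP => gen; move: nF; rewrite nth_default.
    by rewrite index_uniq // (negPf ncn).
  have cf_comb j : \sum_(n < size (jacobian_rows p)) cf n *
      tval (nth None (nth [::] (jacobian_rows p) n) j) = 0.
    rewrite szR; case: (ltnP j 10) => [ltj|gej]; last first.
      rewrite big1 // => n _; rewrite [nth None _ j]nth_default ?mulr0 //.
      by rewrite (eqP (allP rows10 _ (mem_nth _ _))) // szR.
    have /rowP/(_ (Ordinal ltj)) := vM0; rewrite !mxE => vMj.
    rewrite -[RHS]vMj.
    transitivity (\sum_(l <- L) g l * (int_jacobian l j)%:~R).
      rewrite -sum_mask // (big_nth [::]) big_mkord; apply: eq_bigr => n _.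
      rewrite jacobian_rows_entry // /cf; case: ifP => _ //; exact: mul0r.
    by rewrite sumL; apply: eq_bigr => n _; rewrite !mxE gL.
  have cf0 := reduce_sound red rows10 cf_sel cf_comb.
  have iL : nth [::] L i \in L by rewrite mem_nth ?szL.
  have iF : nth [::] L i \in faces5 := mem_mask iL.
  have := cf0 (index (nth [::] L i) faces5); rewrite szR index_mem => /(_ iF).
  by rewrite /cf nth_index // iL gL.
apply/indep_atP => kap kap0 S SL.
(* The sum has at most one term: it reindexes coefficients by point lists, and [cm_scale] passes to
   bare determinants. *)
pose f l : K := (\sum_(T : face 4 | points (val T) == l) kap T) * cm_scale K (size l).
have fE (T : face 4) : f (points (val T)) = kap T * cm_scale K #|val T|.
  rewrite /f size_map -cardE (big_pred1 T) // => T'.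
  by apply/eqP/eqP => [/points_inj/val_inj|->].
suff fL0 l : l \in L -> f l = 0.
  have := fL0 (points (val S)); rewrite inE in SL; rewrite fE => /(_ SL) /eqP.
  by rewrite mulf_eq0 (negPf (cm_scale_neq0 _ _)) orbF => /eqP.
have nz_detK : \det (map_mx (intmul (1 : K)) M) != 0.
  by rewrite det_map_mx intr_eq0.
move=> lL; pose u := \row_(i < 10) f (nth [::] L i).
have u0 : u = 0.
  apply/eqP; case: (eqVneq u 0) => // nz_u; case/negP: nz_detK.
  apply/det0P; exists u => //; apply/rowP => k; rewrite !mxE.
  rewrite -[RHS](kap0 (unit_of k)).
  transitivity (\sum_(l' <- L) f l' * (int_jacobian l' k)%:~R).
    by rewrite (big_nth [::]) szL big_mkord; apply: eq_bigr => i _; rewrite !mxE.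
  rewrite -(@sum_faces_of K L (fun l' => f l' * (int_jacobian l' k)%:~R)) //; last first.
    have /allP vF : all valid_face faces5 by [].
    by apply/allP => l' /mem_mask/vF.
  apply: eq_bigr => T _; rewrite derivation_heron mulrA -fE.
  by rewrite int_jacobianE ?points_inrange.
have := congr1 (fun w : 'rV_10 => w 0 (inord (index l L))) u0; rewrite !mxE.
by rewrite inordK -?szL ?index_mem // nth_index.
Qed.

End RankCertificate.

(** * Codes of sets of faces *)

Fixpoint bits n : seq (seq bool) :=
  if n is m.+1 then map (cons false) (bits m) ++ map (cons true) (bits m) else [:: [::]].

Lemma mem_bits n c : (c \in bits n) = (size c == n).
Proof.
elim: n c => [|n IHn] [|a c] //=; rewrite mem_cat.
  by apply/negP => /orP[] /mapP[].
rewrite eqSS -IHn; apply/orP/idP => [[] /mapP[d] dn [_ ->]//|cn].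
by case: a; [right | left]; apply: map_f.
Qed.

Lemma bits_uniq n : uniq (bits n).
Proof.
elim: n => //= n IHn; rewrite cat_uniq !map_inj_uniq ?IHn //; try by move=> c d [].
by rewrite andbT; apply/hasPn => _ /mapP[c _ ->]; apply/negP => /mapP[].
Qed.

Section Codes.
Implicit Types (B : {set face 4}) (S : face 4) (c : seq bool).

Definition has_face B (l : seq nat) : bool := l \in [seq points (val T) | T in B].

Definition code B : seq bool := [seq has_face B l | l <- faces5].

Lemma has_face_points B S : has_face B (points (val S)) = (S \in B).
Proof.
apply/mapP/idP => [[T TB /points_inj/val_inj->]|SB]; first by rewrite mem_enum in TB.
by exists S; rewrite // mem_enum.
Qed.

Lemma points_id (n : nat) (S : {set 'I_n.+1}) : points S = [seq i <- iota 0 n.+1 | i \in points S].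
Proof.
rewrite -points_set_of_seq; congr points; apply/setP => i.
by rewrite inE mem_points.
Qed.

Lemma points_faces5 S : points (val S) \in faces5.
Proof.
have /allP valid : all (fun m => (2 <= size (mask m (iota 0 5)))%N ==>
  (mask m (iota 0 5) \in faces5)) (bits 5) by [].
have := valid [seq i \in points (val S) | i <- iota 0 5]; rewrite mem_bits size_map size_iota.
rewrite -filter_mask -points_id size_map -cardE (valP S) => /(_ isT).
by [].
Qed.

Lemma faces5_ex l : l \in faces5 -> exists S : face 4, points (val S) = l.
Proof.
have /allP vF : all valid_face faces5 by [].
by move=> /vF/andP[/eqP el szl]; apply: face_ex.
Qed.

Lemma size_code B : size (code B) = 26%N. Proof. by rewrite size_map. Qed.

Lemma codeK B : faces_of (mask (code B) faces5) = B.
Proof.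
apply/setP => S; rewrite inE in_mask // points_faces5 /=.
have iS : (index (points (val S)) faces5 < 26)%N by rewrite index_mem points_faces5.
by rewrite /code (nth_map [::]) // nth_index ?has_face_points ?points_faces5.
Qed.

Lemma code_faces_of c : size c = 26%N -> code (faces_of (mask c faces5)) = c.
Proof.
move=> szc; apply: (@eq_from_nth _ false); rewrite size_code // => i lti.
have iF : nth [::] faces5 i \in faces5 by apply: mem_nth.
rewrite (nth_map [::]) //; have [S eS] := faces5_ex iF.
by rewrite -eS has_face_points inE eS in_mask // iF index_uniq.
Qed.

Lemma count_code B : count id (code B) = #|B|.
Proof.
have := @points_faces_of (mask (code B) faces5) (mask_uniq (erefl : uniq faces5) _).
rewrite codeK => /(_ _)/perm_size; rewrite size_map -cardE size_mask ?size_code // => -> //.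
have /allP vF : all valid_face faces5 by [].
by apply/allP => l /mem_mask/vF.
Qed.

End Codes.

Section Action.
Implicit Types (B : {set face 4}) (S : face 4) (c : seq bool) (s : 'S_5).

Definition perm_seq s : seq nat := [seq val (s i) | i <- enum 'I_5].

Lemma mem_perm_seq s : perm_seq s \in permutations (iota 0 5).
Proof.
rewrite mem_permutations -val_enum_ord /perm_seq (map_comp val s); apply: perm_map.
apply: uniq_perm.
- by rewrite map_inj_uniq ?enum_uniq //; apply: perm_inj.
- exact: enum_uniq.
by move=> i; rewrite mem_enum; apply/mapP; exists (s^-1 i)%g; rewrite ?mem_enum ?permKV.
Qed.

Lemma perm_seq_ex t : t \in permutations (iota 0 5) -> exists s, t = perm_seq s.
Proof.
rewrite mem_permutations => pt; have szt : size t = 5%N by rewrite (perm_size pt) size_iota.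
have /tuple_permP[s es] : perm_eq t (in_tuple (iota 0 5)) by [].
exists s; rewrite es /= /perm_seq; apply: eq_map => i.
by rewrite (tnth_nth 0%N); apply: (@nth_iota 0%N 0%N 5%N); apply: ltn_ord.
Qed.

Definition image_face (t l : seq nat) : seq nat :=
  [seq i <- iota 0 5 | i \in [seq nth 0%N t j | j <- l]].

Lemma nth_perm_seq s (i : 'I_5) : nth 0%N (perm_seq s) i = s i.
Proof. by rewrite (nth_map i) ?size_enum_ord // nth_ord_enum. Qed.

Lemma points_act S s : points (val (face_act S s)) = image_face (perm_seq s) (points (val S)).
Proof.
rewrite [LHS]points_id; apply: eq_in_filter => k; rewrite mem_iota add0n => /= ltk.
rewrite -[k]/(val (Ordinal ltk)) mem_points.
apply/imsetP/mapP => [[j jS ej]|[j jS ej]].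
  by exists (val j); rewrite ?mem_points // nth_perm_seq -ej.
have ltj := points_lt jS; exists (Ordinal ltj); first by rewrite -mem_points.
by apply: val_inj; rewrite ej -[j]/(val (Ordinal ltj)) nth_perm_seq.
Qed.

Local Notation act B s := ((face_action 4)^*%act B s).

(** The inverse makes relabelling a plain rereading: l lies in the image under s^-1 iff its image
    under s lies in [B]. *)
Lemma has_face_act B s l : l \in faces5 ->
  has_face (act B (s^-1)%g) l = has_face B (image_face (perm_seq s) l).
Proof.
move=> /faces5_ex[S <-]; rewrite -points_act !has_face_points.
apply/imsetP/idP => [[T TB ->]|SB].
  by rewrite (_ : face_act _ s = T) //; apply: (actKV (face_action 4)).
exists (face_act S s) => //; exact/esym/(actK (face_action 4)).
Qed.

Definition image_index t L : seq nat := [seq index (image_face t l) L | l <- L].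

Definition block L B : seq bool := [seq has_face B l | l <- L].

Definition relabel (x : seq bool) (ix : seq nat) : seq bool := [seq nth false x k | k <- ix].

Lemma block_act L B s : {subset L <= faces5} ->
  {in L, forall l, image_face (perm_seq s) l \in L} ->
  block L (act B (s^-1)%g) = relabel (block L B) (image_index (perm_seq s) L).
Proof.
move=> LF closed; rewrite /relabel /image_index -[RHS]map_comp; apply/eq_in_map => l lL /=.
rewrite (nth_map [::]) ?index_mem ?closed // nth_index ?closed //.
by rewrite has_face_act ?LF.
Qed.

Definition index_triple t := (image_index t edges5, image_index t tetrahedra5,
  image_index t triangles5).

Definition index_triples := [seq index_triple t | t <- permutations (iota 0 5)].

Definition recode (x y : seq bool) (b : bool) (z : seq bool) (t : seq nat * seq nat * seq nat) :=
  relabel x t.1.1 ++ relabel y t.1.2 ++ b :: relabel z t.2.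

Definition act_code t c :=
  recode (take 10 c) (take 5 (drop 10 c)) (nth false c 15) (drop 16 c) t.

Lemma codeE B : code B = block edges5 B ++ block tetrahedra5 B ++
  has_face B [:: 0; 1; 2; 3; 4]%N :: block triangles5 B.
Proof. by rewrite /code /faces5 !map_cat. Qed.

Lemma code_act B s : code (act B (s^-1)%g) = act_code (index_triple (perm_seq s)) (code B).
Proof.
have tin : perm_seq s \in permutations (iota 0 5) := mem_perm_seq s.
have closed (L : seq (seq nat)) : all (fun t => all (fun l => image_face t l \in L) L)
    (permutations (iota 0 5)) -> {in L, forall l, image_face (perm_seq s) l \in L}.
  by move=> /allP/(_ _ tin)/allP.
have full : image_face (perm_seq s) [:: 0; 1; 2; 3; 4]%N = [:: 0; 1; 2; 3; 4]%N.
  have /allP/(_ _ tin)/eqP // : all (fun t => image_face t [:: 0; 1; 2; 3; 4]%N ==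
    [:: 0; 1; 2; 3; 4]%N) (permutations (iota 0 5)) by [].
rewrite !codeE has_face_act // full.
rewrite (block_act (L := edges5)); last exact: closed; last exact/allP.
rewrite (block_act (L := tetrahedra5)); last exact: closed; last exact/allP.
rewrite (block_act (L := triangles5)); last exact: closed; last exact/allP.
by [].
Qed.

End Action.

(** * Enumeration of canonical codes *)

Section Order.

(* Lexicographic order; on lists of different lengths the result is a junk value. *)
Fixpoint compare_bits (x y : seq bool) : comparison :=
  match x, y with
  | a :: x', b :: y' =>
      if a then (if b then compare_bits x' y' else Gt)
      else (if b then Lt else compare_bits x' y')
  | _, _ => Eq
  end.

Variables (U : Type) (f : seq bool -> U -> seq bool) (x : seq bool).

Fixpoint is_minimal (ts : seq U) : bool :=
  if ts is t :: ts' then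
    if compare_bits x (f x t) is Gt then false else is_minimal ts'
  else true.

(** A permutation that enlarges the block can no longer yield a smaller code and is dropped; one
    that lowers it refutes minimality; the rest must be tested on later blocks. *)
Fixpoint stabilizer (ts : seq U) : option (seq U) :=
  if ts is t :: ts' then
    match compare_bits x (f x t) with
    | Lt => stabilizer ts'
    | Eq => if stabilizer ts' is Some us then Some (t :: us) else None
    | Gt => None
    end
  else Some [::].

End Order.

Fixpoint combinations n k : seq (seq bool) :=
  if n is m.+1 then
    map (cons false) (combinations m k) ++
    (if k is k'.+1 then map (cons true) (combinations m k') else [::])
  else if k is 0 then [:: [::]] else [::].

(* Points at which the Jacobian modulo 3 has the maximal rank on every basis for
   at least one of them; found by random search. *)
Definition sample_points : seq (seq trit) :=
  map (map (fun d => nth None [:: None; Some true; Some false] d)) [::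
    [:: 1; 2; 2; 0; 1; 1; 0; 2; 0; 0];
    [:: 0; 0; 0; 0; 2; 1; 1; 2; 1; 2];
    [:: 2; 2; 0; 0; 2; 1; 2; 2; 1; 1];
    [:: 2; 2; 2; 0; 1; 2; 0; 2; 0; 0];
    [:: 1; 2; 1; 0; 1; 2; 0; 2; 0; 0];
    [:: 2; 1; 2; 0; 1; 1; 0; 2; 0; 0];
    [:: 0; 0; 1; 1; 2; 0; 0; 1; 0; 2];
    [:: 0; 1; 2; 0; 2; 0; 2; 0; 1; 0];
    [:: 2; 1; 0; 2; 1; 2; 1; 0; 2; 0];
    [:: 0; 1; 2; 0; 1; 1; 2; 0; 2; 0];
    [:: 2; 0; 1; 1; 2; 0; 2; 0; 0; 2];
    [:: 2; 1; 0; 1; 2; 2; 2; 2; 2; 2];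
    [:: 2; 0; 0; 0; 2; 1; 1; 2; 1; 2];
    [:: 2; 0; 1; 2; 1; 0; 1; 2; 2; 2];
    [:: 1; 2; 0; 0; 1; 1; 0; 1; 1; 2];
    [:: 0; 1; 1; 0; 1; 2; 0; 1; 2; 0]]%N.

(** Each flat is a graph with all faces whose edges lie in it, and its rank is the number of edges:
    K4, a triangle, K5 minus an edge, K4 minus an edge, K5 minus two adjacent edges, a fan and a
    wheel. *)
Definition edge_flats : seq (nat * seq (seq nat)) := [::
  (6, [:: [:: 0; 1]; [:: 0; 2]; [:: 0; 3]; [:: 1; 2]; [:: 1; 3]; [:: 2; 3];
      [:: 0; 1; 2]; [:: 0; 1; 3]; [:: 0; 2; 3]; [:: 1; 2; 3]; [:: 0; 1; 2; 3]]);
  (3, [:: [:: 0; 1]; [:: 0; 2]; [:: 1; 2]; [:: 0; 1; 2]]);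
  (9, [:: [:: 0; 1]; [:: 0; 2]; [:: 0; 3]; [:: 0; 4]; [:: 1; 2]; [:: 1; 3]; [:: 1; 4];
      [:: 2; 3]; [:: 2; 4]; [:: 0; 1; 2]; [:: 0; 1; 3]; [:: 0; 1; 4]; [:: 0; 2; 3];
      [:: 0; 2; 4]; [:: 1; 2; 3]; [:: 1; 2; 4]; [:: 0; 1; 2; 3]; [:: 0; 1; 2; 4]]);
  (5, [:: [:: 0; 1]; [:: 0; 2]; [:: 0; 3]; [:: 1; 2]; [:: 1; 3]; [:: 0; 1; 2];
      [:: 0; 1; 3]]);
  (8, [:: [:: 0; 1]; [:: 0; 2]; [:: 0; 3]; [:: 0; 4]; [:: 1; 2]; [:: 1; 3]; [:: 1; 4];
      [:: 2; 3]; [:: 0; 1; 2]; [:: 0; 1; 3]; [:: 0; 1; 4]; [:: 0; 2; 3]; [:: 1; 2; 3];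
      [:: 0; 1; 2; 3]]);
  (7, [:: [:: 0; 1]; [:: 0; 2]; [:: 0; 3]; [:: 0; 4]; [:: 1; 2]; [:: 1; 4]; [:: 2; 3];
      [:: 0; 1; 2]; [:: 0; 1; 4]; [:: 0; 2; 3]]);
  (8, [:: [:: 0; 1]; [:: 0; 2]; [:: 0; 3]; [:: 0; 4]; [:: 1; 3]; [:: 1; 4]; [:: 2; 3];
      [:: 2; 4]; [:: 0; 1; 3]; [:: 0; 1; 4]; [:: 0; 2; 3]; [:: 0; 2; 4]])]%N.

Definition flats : seq (nat * seq (seq nat)) :=
  edge_flats ++ [:: (9, bone_tetrahedron); (7, bone); (9, bone_opposite);
    (8, bone_triangle); (9, bone_far); (9, pyramid)]%N.

Definition face_mask (L : seq (seq nat)) : seq bool := [seq l \in L | l <- faces5].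

(** The stored number is rank plus one, the smallest overlap that forces dependence. *)
Definition flat_masks : seq (nat * seq bool) :=
  flatten [seq [seq (rL.1.+1, m) | m <- undup [seq act_code t (face_mask rL.2) | t <- index_triples]]
    | rL <- flats].

Definition overlap (c m : seq bool) : nat := count (fun p => p.1 && p.2) (zip c m).

Fixpoint at_least (c m : seq bool) (n : nat) : bool :=
  if n is n'.+1 then
    match c, m with
    | a :: c', b :: m' => at_least c' m' (if a then (if b then n' else n) else n)
    | _, _ => false
    end
  else true.

(* The conditions on the last ten digits of a code starting with y under which
   it meets one of the flats in a dependent set. *)
Definition triangle_conditions (y : seq bool) (k : nat) : seq (nat * seq bool) :=
  [seq nm <- [seq (nm.1 - overlap y (take 16 nm.2), drop 16 nm.2)%N | nm <- flat_masks]
    | (nm.1 <= k)%N && (nm.1 <= count id nm.2)%N].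

Fixpoint is_dependent (cs : seq (nat * seq bool)) (z : seq bool) : bool :=
  if cs is nm :: cs' then if at_least z nm.2 nm.1 then true else is_dependent cs' z
  else false.

Fixpoint is_independent (k : nat) (z : seq bool) (sts : seq (option (seq (seq trit)))) : bool :=
  if sts is st :: sts' then
    if (if st is Some rs then if reduce z k rs is Some _ then true else false else false)
    then true else is_independent k z sts'
  else false.

(** Only codes that fail at the first sample point and meet no flat are tried at the remaining
    fifteen points. *)
Definition verdict k sts cs z : option bool :=
  if is_independent k z (take 1 sts) then Some true
  else if is_dependent cs z then Some false
  else if is_independent k z (behead sts) then Some true else None.

Definition reduce_all s k (sts : seq (option (seq (seq trit)))) :=
  [seq if st is Some rs then reduce s k rs else None | st <- sts].

Definition triples := (seq nat * seq nat * seq nat)%type.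

Definition classify_triangles x y b k sts (ts : seq triples) : seq (seq bool * option bool) :=
  let cs := triangle_conditions (x ++ y ++ [:: b]) k in
  flatten [seq if is_minimal (fun z t => relabel z t.2) z ts
               then [:: (x ++ y ++ b :: z, verdict k sts cs z)] else [::]
    | z <- combinations 10 k].

Definition classify_tetrahedra x k sts (ts : seq triples) y :=
  if stabilizer (fun y t => relabel y t.1.2) y ts is Some us then
    flatten [seq let s := rcons y b in
      if (count id s <= k)%N then
        classify_triangles x y b (k - count id s) (reduce_all s k sts) us
      else [::] | b <- [:: false; true]]
  else [::].

Definition classify_edges sts (ts : seq triples) x :=
  if stabilizer (fun x t => relabel x t.1.1) x ts is Some us then
    flatten [seq classify_tetrahedra x (10 - count id x) (reduce_all x 10 sts) us y | y <- bits 5]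
  else [::].

Definition classification : seq (seq bool * option bool) :=
  let sts := [seq Some (jacobian_rows p) | p <- sample_points] in
  flatten [seq classify_edges sts index_triples x | x <- bits 10].

(** Binary counters keep the count cheap; one undecided code makes the whole result [None]. *)
Fixpoint tally (l : seq (seq bool * option bool)) (u v : BinNums.N) : option (BinNums.N * BinNums.N) :=
  match l with
  | [::] => Some (u, v)
  | (_, None) :: _ => None
  | (_, Some b) :: l' => if b then tally l' (BinNat.N.succ u) v else tally l' u (BinNat.N.succ v)
  end.

(** * Canonical representatives of orbits *)

Section CompareBits.
Implicit Types x y : seq bool.

(** The binary value, leading digit first, turns the lexicographic order into that of integers, so
    that an orbit has a minimizer. *)
Fixpoint bits_value x : nat :=
  (if x is a :: x' then (if a then 2 ^ size x' else 0) + bits_value x' else 0)%N.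

Lemma bits_value_lt x : (bits_value x < 2 ^ size x)%N.
Proof.
elim: x => //= a x IHx; rewrite expnS mul2n -addnn.
by case: a; [rewrite ltn_add2l | exact: leq_trans IHx (leq_addr _ _)].
Qed.

Lemma compare_bitsP x y : size x = size y ->
  match compare_bits x y with
  | Lt => bits_value x < bits_value y
  | Eq => x = y
  | Gt => bits_value y < bits_value x
  end%N.
Proof.
elim: x y => [|a x IHx] [|b y] //= /eqP; rewrite eqSS => /eqP exy.
have := IHx y exy; rewrite exy.
case: a; case: b => //=.
- by case: compare_bits => // [->//||]; rewrite ltn_add2l.
- by move=> _; exact: leq_trans (bits_value_lt y) (leq_addr _ _).
- by move=> _; rewrite -exy; exact: leq_trans (bits_value_lt x) (leq_addr _ _).
by case: compare_bits => // ->.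
Qed.

Lemma compare_bits_cat x x' y y' : size x = size x' ->
  compare_bits (x ++ y) (x' ++ y') =
  if compare_bits x x' is Eq then compare_bits y y' else compare_bits x x'.
Proof.
by elim: x x' => [|a x IHx] [|b x'] //= [/IHx]; case: a; case: b.
Qed.

Section Minimal.
Variables (U : Type) (f : seq bool -> U -> seq bool) (x : seq bool).

Definition not_gt y := if compare_bits x y is Gt then false else true.

Lemma is_minimalE ts : is_minimal f x ts = all (fun t => not_gt (f x t)) ts.
Proof. by elim: ts => //= t ts ->; rewrite /not_gt; case: compare_bits. Qed.

End Minimal.
End CompareBits.

Definition canonical (c : seq bool) := is_minimal (fun c t => act_code t c) c index_triples.

Section Orbits.
Implicit Types B : {set face 4}.
Local Notation act B s := ((face_action 4)^*%act B s).
Local Notation G := [set: 'S_5].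

Lemma card_canonical k (P : pred {set face 4}) :
  (forall B s, #|B| = k -> P (act B s) = P B) ->
  #|[set O in face_set_orbits 4 k | [forall B in O, P B]]%SET| =
  #|[set B : {set face 4} | [&& #|B| == k, canonical (code B) & P B]]%SET|.
Proof.
move=> Pact; set Y := ([set B : {set face 4} | _])%SET.
have actE B s : code (act B s) = act_code (index_triple (perm_seq s^-1%g)) (code B).
  by rewrite -code_act invgK.
have canP B s : canonical (code B) -> (bits_value (code B) <= bits_value (code (act B s)))%N.
  rewrite /canonical is_minimalE => /allP can.
  have := can _ (map_f index_triple (mem_perm_seq s^-1%g)); rewrite -actE /not_gt.
  have := @compare_bitsP (code B) (code (act B s)); rewrite !size_code => /(_ erefl).
  by case: compare_bits => // [->|/ltnW].
have code_inj B B' : bits_value (code B) = bits_value (code B') -> B = B'.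
  move=> ev; have := @compare_bitsP (code B) (code B'); rewrite !size_code ev => /(_ erefl).
  by case: compare_bits; rewrite ?ltnn // => eBB; rewrite -(codeK B) eBB codeK.
have -> : [set O in face_set_orbits 4 k | [forall B in O, P B]]%SET =
    [set orbit (face_action 4)^* G B | B in Y]%SET.
  apply/setP => O; rewrite !inE; apply/andP/imsetP => [[/imsetP[B0]]|[B]].
    rewrite inE => /eqP cB0 eO /forall_inP PO.
    have B0O : B0 \in O by rewrite eO orbit_refl.
    pose B := [arg min_(B < B0 in O) bits_value (code B)].
    have [BO minB] : B \in O /\ forall B', B' \in O -> (bits_value (code B) <= bits_value (code B'))%N.
      by rewrite /B; case: arg_minnP.
    have eOB : O = orbit (face_action 4)^* G B by rewrite eO; apply/esym/orbit_eqP; rewrite -eO.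
    exists B => //; rewrite inE PO // andbT; apply/andP; split.
      by move: BO; rewrite eO => /orbitP[s _ <-]; rewrite card_setact cB0.
    rewrite /canonical is_minimalE; apply/allP => _ /mapP[t tP ->].
    have [s ->] := perm_seq_ex tP; rewrite -code_act /not_gt.
    have /minB le : act B s^-1%g \in O by rewrite eOB; apply: mem_orbit; rewrite inE.
    have := @compare_bitsP (code B) (code (act B s^-1%g)); rewrite !size_code => /(_ erefl).
    by case: compare_bits => //; rewrite ltnNge le.
  rewrite inE => /and3P[cB _ PB] ->; split; first by apply/imsetP; exists B; rewrite ?inE.
  by apply/forall_inP => _ /orbitP[s _ <-]; rewrite Pact // (eqP cB).
(* Two canonical sets in one orbit are relabellings of each other, so each code is at most the
   other. *)
rewrite card_in_imset // => B B'; rewrite !inE => /and3P[_ canB _] /and3P[_ canB' _] eO.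
have : B' \in orbit (face_action 4)^* G B by rewrite eO orbit_refl.
case/orbitP => s _ eB'; apply: code_inj; apply/eqP; rewrite eqn_leq.
rewrite -{1}eB' canP //= (_ : B = act B' s^-1%g) ?canP //.
by rewrite -eB' actK.
Qed.

End Orbits.

(** * Correctness of the enumeration *)

Lemma mem_combinations n k c : (c \in combinations n k) = (size c == n) && (count id c == k).
Proof.
elim: n k c => [|n IHn] k [|a c] //=; try by case: k.
- by rewrite mem_cat; apply/negP => /orP[/mapP[] //|]; case: k => // k /mapP[].
rewrite mem_cat eqSS; apply/orP/andP => [[/mapP[d + [-> ->]]|]|[szc]].
- by rewrite IHn => /andP[].
- by case: k => // k /mapP[d + [-> ->]]; rewrite IHn add1n eqSS => /andP[].
case: a; rewrite ?add0n => cc; last by left; apply: map_f; rewrite IHn szc.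
right; case: k cc => // k; rewrite add1n eqSS => cc.
by apply: map_f; rewrite IHn szc.
Qed.

Lemma combinations_uniq n k : uniq (combinations n k).
Proof.
have consI b : injective (cons b : seq bool -> seq bool) by move=> c d [].
elim: n k => [|n IHn] [|k] //=; rewrite ?cats0 ?map_inj_uniq //.
rewrite cat_uniq !map_inj_uniq // !IHn andbT /=.
by apply/hasPn => _ /mapP[c _ ->]; apply/negP => /mapP[].
Qed.

Lemma flatten_map_uniq (A B : eqType) (h : A -> seq B) (key : B -> A) s :
  uniq s -> {in s, forall a, uniq (h a)} ->
  {in s, forall a, {in h a, forall b, key b = a}} ->
  uniq (flatten [seq h a | a <- s]).
Proof.
elim: s => //= a s IHs /andP[as' sU] hU hkey.
rewrite cat_uniq hU ?mem_head ?IHs // ?andbT; first last.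
- by move=> a' a's; apply: hkey; rewrite inE a's orbT.
- by move=> a' a's; apply: hU; rewrite inE a's orbT.
apply/hasPn => b /flatten_mapP[a' a's ba']; apply: contra as' => ba.
by rewrite -(hkey a _ b ba) ?mem_head // (hkey a' _ b ba') // inE a's orbT.
Qed.

Section Classification.
Variables (sts : seq (option (seq (seq trit)))) (ts : seq triples).
Hypothesis ts_size : all (fun t => (size t.1.1 == 10%N) && (size t.1.2 == 5%N)) ts.

Definition classify := flatten [seq classify_edges sts ts x | x <- bits 10].

Definition verdict_of (c : seq bool) : option bool :=
  let x := take 10 c in let y := take 5 (drop 10 c) in let b := nth false c 15 in
  let s := rcons y b in let k := (10 - count id x)%N in
  verdict (k - count id s)%N (reduce_all s k (reduce_all x 10 sts))
    (triangle_conditions (x ++ y ++ [:: b]) (k - count id s)) (drop 16 c).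

Lemma size_relabel x ix : size (relabel x ix) = size ix. Proof. exact: size_map. Qed.

Lemma split_code (x y : seq bool) b z : size x = 10%N -> size y = 5%N ->
  let c := x ++ y ++ b :: z in
  [/\ take 10 c = x, take 5 (drop 10 c) = y, nth false c 15 = b & drop 16 c = z].
Proof.
move=> szx szy c; rewrite /c take_size_cat // drop_size_cat // take_size_cat //.
by rewrite nth_cat szx /= nth_cat szy /= drop_cat szx /= drop_cat szy /= drop0.
Qed.

Lemma code_split (c : seq bool) : size c = 26%N ->
  exists x y b z, [/\ c = x ++ y ++ b :: z, size x = 10%N, size y = 5%N & size z = 10%N].
Proof.
move=> szc; exists (take 10 c), (take 5 (drop 10 c)), (nth false c 15), (drop 16 c).
split; rewrite ?size_takel ?size_drop ?szc //.
rewrite -drop_nth ?szc //.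
have <- : drop 5 (drop 10 c) = drop 15 c by rewrite drop_drop.
by rewrite !cat_take_drop.
Qed.

(** Justifies the pruning: the first block on which a relabelling differs decides the comparison,
    and the digit of the full simplex never differs. *)
Lemma is_minimal_split x y b z : size x = 10%N -> size y = 5%N ->
  is_minimal (fun c t => act_code t c) (x ++ y ++ b :: z) ts =
  if stabilizer (fun x t => relabel x t.1.1) x ts is Some us then
    if stabilizer (fun y t => relabel y t.1.2) y us is Some vs then
      is_minimal (fun z t => relabel z t.2) z vs
    else false
  else false.
Proof.
move=> szx szy; elim: ts ts_size => //= t us IHus /andP[/andP[/eqP sz1 /eqP sz2] /IHus ->].
have [ex ey eb ez] := split_code b z szx szy.
rewrite {1}/act_code ex ey eb ez /recode compare_bits_cat ?size_relabel ?sz1 //.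
case: (compare_bits x) => //; case: stabilizer => [vs|]; last by case: compare_bits.
rewrite compare_bits_cat ?size_relabel ?sz2 //=.
case: (compare_bits y) => //; case: stabilizer => [ws|]; last first.
  by case: (b); case: compare_bits.
by case: (b).
Qed.

Lemma mem_classify e : (e \in classify) =
  [&& size e.1 == 26%N, count id e.1 == 10%N,
    is_minimal (fun c t => act_code t c) e.1 ts & e.2 == verdict_of e.1].
Proof.
apply/flatten_mapP/idP => [[x]|/and4P[/eqP/code_split[x [y [b [z [ec szx szy szz]]]]]]].
  rewrite mem_bits /classify_edges => /eqP szx; case ex: stabilizer => [us|] //.
  case/flatten_mapP=> y; rewrite mem_bits /classify_tetrahedra => /eqP szy.
  case ey: stabilizer => [vs|] // /flatten_mapP[b _]; case: ifP => // leb.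
  case/flatten_mapP=> z; rewrite mem_combinations => /andP[/eqP szz /eqP cz].
  case: ifP => // minz; rewrite inE => /eqP -> /=.
  have [e1 e2 e3 e4] := split_code b z szx szy.
  rewrite is_minimal_split // ex ey minz /verdict_of e1 e2 e3 e4 eqxx.
  rewrite !size_cat /= szx szy szz !count_cat /= cz andbT /=.
  (* The subtraction from 10 is truncated, so the total is 10 only because [x] has at most ten
     ones. *)
  have := count_size id x; rewrite szx => lex; move: leb; rewrite -cats1 count_cat /=; lia.
rewrite ec => cc minc /eqP ev.
have [e1 e2 e3 e4] := split_code b z szx szy.
move: minc; rewrite is_minimal_split //.
case ex: stabilizer => [us|] //; case ey: stabilizer => [vs|] // minz.
exists x; first by rewrite mem_bits szx.
rewrite /classify_edges ex; apply/flatten_mapP; exists y; first by rewrite mem_bits szy.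
rewrite /classify_tetrahedra ey; apply/flatten_mapP; exists b; first by case: (b).
move: cc; rewrite !count_cat /= => /eqP cc.
have cs : count id (rcons y b) = (count id y + b)%N by rewrite -cats1 count_cat /= addn0.
rewrite ifT; last by rewrite cs; lia.
apply/flatten_mapP; exists z; first by rewrite mem_combinations szz cs /=; lia.
rewrite minz inE; apply/eqP.
by rewrite [LHS]surjective_pairing ev ec /verdict_of e1 e2 e3 e4.
Qed.

Lemma classify_triangles_prefix x y b k sts' ts' e :
  e \in classify_triangles x y b k sts' ts' -> exists z, e.1 = x ++ y ++ b :: z.
Proof.
move=> /flatten_mapP[z _]; case: ifP => // _; rewrite inE => /eqP->.
by exists z.
Qed.

Lemma classify_tetrahedra_prefix x k sts' ts' y e :
  e \in classify_tetrahedra x k sts' ts' y -> exists b z, e.1 = x ++ y ++ b :: z.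
Proof.
rewrite /classify_tetrahedra; case: stabilizer => // us /flatten_mapP[b _].
by case: ifP => // _ /classify_triangles_prefix[z ->]; exists b, z.
Qed.

Lemma classify_edges_prefix x e : e \in classify_edges sts ts x ->
  exists y b z, e.1 = x ++ y ++ b :: z.
Proof.
rewrite /classify_edges; case: stabilizer => // us /flatten_mapP[y _].
by move=> /classify_tetrahedra_prefix[b [z ->]]; exists y, b, z.
Qed.

Lemma classify_uniq : uniq classify.
Proof.
apply: (flatten_map_uniq (key := fun e => take 10 e.1)) => [|x|x]; rewrite ?bits_uniq //;
  rewrite mem_bits => /eqP szx; last first.
  by move=> e /classify_edges_prefix[y [b [z ->]]]; rewrite take_size_cat.
rewrite /classify_edges; case: stabilizer => // us.
apply: (flatten_map_uniq (key := fun e => take 5 (drop 10 e.1))) => [|y|y];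
  rewrite ?bits_uniq //; rewrite mem_bits => /eqP szy; last first.
  by move=> e /classify_tetrahedra_prefix[b [z ->]]; have [] := split_code b z szx szy.
rewrite /classify_tetrahedra; case: stabilizer => // vs.
apply: (flatten_map_uniq (key := fun e => nth false e.1 15)) => // b _; case: ifP => // _;
  last first.
  by move=> e /classify_triangles_prefix[z ->]; have [] := split_code b z szx szy.
apply: (flatten_map_uniq (key := fun e => drop 16 e.1)) => [|z _|z _ e].
- exact: combinations_uniq.
- by case: ifP.
case: ifP => // _; rewrite inE => /eqP-> /=.
by have [] := split_code b z szx szy.
Qed.

End Classification.

(** * Soundness of the verdicts *)

Section Verdicts.
Implicit Types (c x y z : seq bool).

Lemma is_independentE k z sts : is_independent k z sts ->
  exists rs q, Some rs \in sts /\ reduce z k rs = Some q.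
Proof.
elim: sts => //= [[rs|]] sts IHsts; last first.
  by move=> /IHsts[rs [q [rsin eq]]]; exists rs, q; rewrite inE rsin orbT.
case eq: reduce => [q|]; first by exists rs, q; rewrite mem_head.
by move=> /IHsts[rs' [q [rsin eq']]]; exists rs', q; rewrite inE rsin orbT.
Qed.

Lemma mem_reduce_all s k sts rs : Some rs \in reduce_all s k sts ->
  exists2 rs', Some rs' \in sts & reduce s k rs' = Some rs.
Proof. by case/mapP=> [[rs'|]] // stsin ->; exists rs'. Qed.

Lemma at_leastE c m n : at_least c m n = (n <= overlap c m)%N.
Proof.
rewrite /overlap; elim: c m n => [|a c IHc] [|b m] [|n] //=.
by case: a; case: b; rewrite /= IHc.
Qed.

Lemma overlap_cat x z m :
  overlap (x ++ z) m = (overlap x (take (size x) m) + overlap z (drop (size x) m))%N.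
Proof.
rewrite /overlap; elim: x m => [|a x IHx] m; first by rewrite take0 drop0.
by case: m => [|b m] /=; [case: (z) | rewrite IHx addnA].
Qed.

Lemma is_dependentE cs z : is_dependent cs z -> exists2 nm, nm \in cs & (nm.1 <= overlap z nm.2)%N.
Proof.
elim: cs => //= nm cs IHcs; rewrite at_leastE; case: ifP => [le _|_ /IHcs[nm' nmin le]].
  by exists nm; rewrite ?mem_head.
by exists nm'; rewrite // inE nmin orbT.
Qed.

Lemma triangle_conditionsE y k z : size y = 16%N -> is_dependent (triangle_conditions y k) z ->
  exists2 nm, nm \in flat_masks & (nm.1 <= overlap (y ++ z) nm.2)%N.
Proof.
move=> szy /is_dependentE[nm' + +]; rewrite mem_filter => /andP[_ /mapP[nm nmin ->]] /= le.
by exists nm => //; rewrite overlap_cat szy -leq_subLR.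
Qed.

Lemma verdict_independent k sts cs z : verdict k sts cs z = Some true ->
  is_independent k z (take 1 sts) \/ is_independent k z (behead sts).
Proof.
rewrite /verdict; case: ifP => [_ _|_]; first by left.
by case: ifP => // _; case: ifP => // _ _; right.
Qed.

Lemma verdict_dependent k sts cs z : verdict k sts cs z = Some false -> is_dependent cs z.
Proof. by rewrite /verdict; case: ifP => // _; case: ifP => // _; case: ifP. Qed.

Section Verdict.
Variables (sts : seq (option (seq (seq trit)))) (c : seq bool).
Hypothesis szc : size c = 26%N.

Lemma verdict_true : (forall rs, Some rs \in sts -> size rs = 26%N) ->
  verdict_of sts c = Some true -> exists rs q, Some rs \in sts /\ reduce c 10 rs = Some q.
Proof.
move=> szsts; have [x [y [b [z [ec szx szy szz]]]]] := code_split szc.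
have [e1 e2 e3 e4] := split_code b z szx szy.
rewrite /verdict_of ec e1 e2 e3 e4; set k := (10 - _ - _)%N.
set sts' := reduce_all _ _ _; set cs := triangle_conditions _ _.
have red i j : is_independent k z (take i (drop j sts')) -> exists rs q,
    Some rs \in sts /\ reduce (x ++ y ++ b :: z) 10 rs = Some q.
  move=> /is_independentE[rs2 [q [/mem_take/mem_drop/mem_reduce_all[rs1]]]].
  move=> /mem_reduce_all[rs rsin eq0] eq1 eq2; exists rs, q; split=> //.
  rewrite -cat_rcons catA !reduce_cat ?size_cat ?size_rcons ?szx ?szy ?szsts //.
  by rewrite eq0 eq1 count_cat subnDA -/k.
case/verdict_independent=> ind; first by apply: (red 1%N 0%N); rewrite drop0.
by apply: (red (size sts') 1%N); rewrite take_oversize ?drop1 // size_behead leq_pred.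
Qed.

Lemma verdict_false : verdict_of sts c = Some false ->
  exists2 nm, nm \in flat_masks & (nm.1 <= overlap c nm.2)%N.
Proof.
have [x [y [b [z [ec szx szy szz]]]]] := code_split szc.
have [e1 e2 e3 e4] := split_code b z szx szy.
rewrite /verdict_of ec e1 e2 e3 e4 => /verdict_dependent/triangle_conditionsE.
by rewrite -!catA /=; apply; rewrite !size_cat szx szy.
Qed.

End Verdict.

Lemma size_jacobian_rows p : size (jacobian_rows p) = 26%N.
Proof. exact: size_map. Qed.

End Verdicts.

(** * Invariance of the matroid and soundness of the classification *)

Section MatroidInvariance.
Variable K : numFieldType.
Implicit Types (B Q : {set face 4}) (s : 'S_5).
Local Notation act B s := ((face_action 4)^*%act B s).
Local Notation basis B := (algebraic_matroid_basis (@heron_variety K 4) B).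

Lemma basis_act_sub B s : #|B| = 10%N -> basis B -> basis (act B s).
Proof.
move=> cardB; rewrite heron_varietyE => basisB.
apply: (@basis_relabel K _ _ (@heron_poly K 4) (fun S => face_act S s)
  (fun S => face_act S s^-1%g) (edge_act s) (edge_act s^-1%g) B) basisB.
- exact: (actK (face_action 4)).
- exact: edge_actK.
- by rewrite cardB card_edge4.
move=> x S; rewrite /parametrization !heron_polyE; exact: heron_map_perm.
Qed.

Lemma basis_act B s : #|B| = 10%N -> basis (act B s) <-> basis B.
Proof.
move=> cardB; split; last exact: basis_act_sub.
move=> /(basis_act_sub s^-1%g); rewrite card_setact actK; exact.
Qed.

(** Instead of transporting the rank bound to the relabelled flat, [B] is moved back by the inverse
    permutation. *)
Lemma rank_at_most_act Q r B s : rank_at_most K Q r -> #|B| = 10%N ->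
  (r < #|B :&: act Q s|)%N -> ~ basis B.
Proof.
move=> rkQ cardB; rewrite -(card_setact (face_action 4) _ s^-1%g) => ltr /(basis_act _ cardB) basisB.
apply: (rank_at_most_nonbasis (B := act B s^-1%g) rkQ) ; last exact/basisB.
  by rewrite card_setact cardB card_edge4.
apply: leq_trans ltr _; apply/subset_leq_card/fintype.subsetP => S.
case/imsetP=> T; rewrite inE => /andP[TB TQ] ->; rewrite inE mem_setact //=.
by have := mem_setact (face_action 4) s^-1%g TQ; rewrite actK.
Qed.

Lemma flats_rank r L : (r, L) \in flats -> rank_at_most K (faces_of L) r.
Proof.
rewrite mem_cat => /orP[|]; last first.
  rewrite !inE => /orP[/eqP[-> ->]|]; first exact: bone_tetrahedron_rank.
  move=> /orP[/eqP[-> ->]|]; first exact: bone_rank.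
  move=> /orP[/eqP[-> ->]|]; first exact: bone_opposite_rank.
  move=> /orP[/eqP[-> ->]|]; first exact: bone_triangle_rank.
  move=> /orP[/eqP[-> ->]|/eqP[-> ->]]; [exact: bone_far_rank | exact: pyramid_rank].
have /allP edges : all (fun rL => let E := [seq l <- rL.2 | size l == 2%N] in
  (size E == rL.1) && all (fun l => all (fun p => p \in E) (edge_pairs l)) rL.2) edge_flats by [].
by move=> /edges/andP[/eqP er /(edge_rank K)]; rewrite er.
Qed.

Lemma overlap_code B Q : overlap (code B) (code Q) = #|B :&: Q|.
Proof.
rewrite /overlap /code zip_map count_map -count_code count_map; apply: eq_in_count => l /faces5_ex[S <-] /=.
by rewrite !has_face_points inE.
Qed.

Lemma code_faces L : code (faces_of L) = face_mask L.
Proof. by apply/eq_in_map => _ /faces5_ex[S <-]; rewrite has_face_points inE. Qed.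

Lemma flat_masksE n m : (n, m) \in flat_masks ->
  exists r L s, [/\ n = r.+1, (r, L) \in flats & m = code (act (faces_of L) s)].
Proof.
case/flatten_mapP=> [[r L]] rL /mapP[m']; rewrite mem_undup => /mapP[_ /mapP[t tP ->] ->] [-> ->].
have [s ->] := perm_seq_ex tP; exists r, L, s^-1%g; split=> //.
by rewrite code_act code_faces.
Qed.

Lemma classification_sound B (v := verdict_of [seq Some (jacobian_rows p) | p <- sample_points] (code B)) :
  #|B| = 10%N -> (v = Some true -> basis B) /\ (v = Some false -> ~ basis B).
Proof.
move=> cardB; split.
  move=> /(verdict_true (size_code B))[_ /mapP[p _ [->]]|rs [q [/mapP[p _ [->]]]]].
    exact: size_jacobian_rows.
  move=> /(@rank_certificate K p _ q (size_code B)); rewrite count_code codeK => /(_ cardB).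
  by move=> /indep_gradients_basis; rewrite heron_varietyE; apply; rewrite cardB card_edge4.
move=> /(verdict_false (size_code B))[[n m]] /flat_masksE[r [L [s [-> rL ->]]]] /=.
by rewrite overlap_code; apply: rank_at_most_act => //; exact: flats_rank.
Qed.

End MatroidInvariance.

(** * Counts *)

Lemma tallyE l u v u' v' : tally l u v = Some (u', v') ->
  [/\ BinNat.N.to_nat u' = (BinNat.N.to_nat u + count (fun e => e.2 == Some true) l)%N,
    BinNat.N.to_nat v' = (BinNat.N.to_nat v + count (fun e => e.2 == Some false) l)%N &
    all (fun e => e.2 != None) l].
Proof.
elim: l u v => [|[c [b|]] l IHl] u v //=; first by case=> -> ->; rewrite !addn0.
by case: b => /IHl[-> -> ->]; rewrite Nnat.N2Nat.inj_succ; split; rewrite ?addSnnS.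
Qed.

Lemma tally_counts l u v : tally l BinNums.N0 BinNums.N0 = Some (u, v) ->
  [/\ all (fun e => e.2 != None) l,
    count (fun e => e.2 == Some true) l = BinNat.N.to_nat u,
    count (fun e => e.2 == Some false) l = BinNat.N.to_nat v &
    size l = (BinNat.N.to_nat u + BinNat.N.to_nat v)%N].
Proof.
move=> /tallyE[-> -> decided]; split=> //; rewrite !add0n.
by elim: l decided => //= -[c [[]|]] //= l IHl /IHl ->; rewrite ?addnS.
Qed.

Lemma classification_tally : tally classification BinNums.N0 BinNums.N0 =
  Some (BinNums.Npos 35887%AC, BinNums.Npos 12646%AC).
Proof. by vm_compute. Qed.

Lemma index_triples_size :
  all (fun t => (size t.1.1 == 10%N) && (size t.1.2 == 5%N)) index_triples.
Proof. by vm_compute. Qed.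

Local Notation jacobians := [seq Some (jacobian_rows p) | p <- sample_points].

Lemma mem_classification e : (e \in classification) =
  [&& size e.1 == 26%N, count id e.1 == 10%N, canonical e.1 & e.2 == verdict_of jacobians e.1].
Proof. exact: (mem_classify jacobians index_triples_size). Qed.

Lemma classification_uniq : uniq classification.
Proof. exact: (@classify_uniq jacobians index_triples). Qed.

Lemma card_classified (P : pred {set face 4}) (p : pred (option bool)) :
  (forall B : {set face 4}, #|B| = 10%N -> canonical (code B) -> P B = p (verdict_of jacobians (code B))) ->
  #|[set B : {set face 4} | [&& #|B| == 10%N, canonical (code B) & P B]]%SET| =
  count (fun e => p e.2) classification.
Proof.
move=> Pp; rewrite cardE -size_filter.
rewrite -(size_map (fun B : {set face 4} => (code B, verdict_of jacobians (code B)))); apply/perm_size/uniq_perm.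
- rewrite map_inj_uniq => [|B B' eBB]; first exact: enum_uniq.
  by rewrite -(codeK B) (congr1 fst eBB : code B = code B') codeK.
- exact/filter_uniq/classification_uniq.
move=> [c v]; rewrite mem_filter mem_classification /=; apply/mapP/and5P.
  move=> [B]; rewrite mem_enum inE => /and3P[/eqP cB canB PB] [-> ->].
  by rewrite size_code count_code cB -Pp // PB canB.
move=> [pv /eqP szc /eqP cc can /eqP ev]; exists (faces_of (mask c faces5)); last first.
  by rewrite code_faces_of // ev.
have cB : #|faces_of (mask c faces5)| = 10%N by rewrite -count_code code_faces_of.
by rewrite mem_enum inE cB eqxx Pp // code_faces_of // can -ev.
Qed.

Section Counts.
Variable K : numFieldType.
Implicit Types B : {set face 4}.
Local Notation basis B := (algebraic_matroid_basis (@heron_variety K 4) B).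

(** Soundness gives one implication per verdict; they become equivalences because the tally leaves
    no canonical code undecided. *)
Lemma verdict_basis B : #|B| = 10%N -> canonical (code B) ->
  (`[< basis B >] = (verdict_of jacobians (code B) == Some true)) *
  (~~ `[< basis B >] = (verdict_of jacobians (code B) == Some false)).
Proof.
move=> cB can; have [soundT soundF] := classification_sound K cB.
have : (code B, verdict_of jacobians (code B)) \in classification.
  by rewrite mem_classification size_code count_code cB can /= eqxx.
have [/allP decided _ _ _] := tally_counts classification_tally; move=> /decided /=.
case: verdict_of soundT soundF => [[]|] //.
  by move=> /(_ erefl)/asboolT-> _ _.
by move=> _ /(_ erefl)/asboolF-> _.
Qed.

Lemma card_orbits_basis (P : pred {set face 4}) (p : pred (option bool)) :
  (forall B, #|B| = 10%N -> canonical (code B) -> P B = p (verdict_of jacobians (code B))) ->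
  (forall B s, #|B| = 10%N -> P ((face_action 4)^*%act B s) = P B) ->
  #|[set O in face_set_orbits 4 10 | [forall B in O, P B]]%SET| =
  count (fun e => p e.2) classification.
Proof. by move=> Pp Pact; rewrite card_canonical //; exact: card_classified. Qed.

Lemma orbits_basis : #|[set O in face_set_orbits 4 10
    | [forall B in O, `[< basis B >]]]%SET| =
  count (fun e => e.2 == Some true) classification.
Proof.
apply: (card_orbits_basis (p := fun v => v == Some true)) => [B cB can|B s cB].
  by rewrite verdict_basis.
by apply: asbool_equiv_eq; exact: basis_act.
Qed.

Lemma orbits_nonbasis : #|[set O in face_set_orbits 4 10
    | [forall B in O, ~~ `[< basis B >]]]%SET| =
  count (fun e => e.2 == Some false) classification.
Proof.
apply: (card_orbits_basis (p := fun v => v == Some false)) => [B cB can|B s cB].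
  by rewrite verdict_basis.
by congr (~~ _); apply: asbool_equiv_eq; exact: basis_act.
Qed.

End Counts.

Lemma card_orbits : #|face_set_orbits 4 10| = size classification.
Proof.
rewrite -count_predT -(@card_orbits_basis predT predT) //.
by congr #|pred_of_set _|; apply/setP => O; rewrite [RHS]inE; apply/esym/andb_idr => _; apply/forall_inP.
Qed.


(* The decimal numerals are parsed into calls of Nat.of_num_uint, which lia can
   only digest once their tail-recursive multiplications by ten are replaced. *)
Lemma tally_numerals (u := BinNat.N.to_nat (BinNums.Npos 35887%AC))
    (v := BinNat.N.to_nat (BinNums.Npos 12646%AC)) :
  [/\ u = 35887%N, v = 12646%N & (u + v)%N = 48533%N].
Proof.
rewrite /u /v; cbv beta iota delta [Nat.of_num_uint Nat.of_uint Nat.of_uint_acc].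
by rewrite !PeanoNat.Nat.tail_mul_spec; split; lia.
Qed.

Local Open Scope complex_scope.

Theorem theorem4p8 (R : realType) :
  let basis (B : {set face 4}) :=
    algebraic_matroid_basis (@heron_variety R[i] 4) B in
  [/\ #|face_set_orbits 4 10| = 48533%N,
      #|[set O in face_set_orbits 4 10
          | [forall B in O, `[< basis B >]]]%SET| = 35887%N &
      #|[set O in face_set_orbits 4 10
          | [forall B in O, ~~ `[< basis B >]]]%SET| = 12646%N].
Proof.
have [eu ev euv] := tally_numerals.
have [_ cu cv cuv] := tally_counts classification_tally.
split; first by rewrite -euv -cuv; exact: card_orbits.
  by rewrite -eu -cu; exact: orbits_basis.
by rewrite -ev -cv; exact: orbits_nonbasis.
Qed.
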